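(* $Q(X)=G(X)/\widehat{\mathcal{C}}$ equipped with $\tau''$ is a topological group. Moreover, the homomorphism $\widehat P:G(X)\to G_c[[r]]$ determines an isomorphism of topological groups $\overline P:Q(X)\to G_c[[r]]$ defined by $\widehat P=\overline P\circ\pi$.
   Context: Functions on the circle $S^1$ are identified with $2\pi$-periodic functions on $\mathbb{R}$. $X$ is the complex vector space of sequences $a=(a_1,a_2,\dots)$ with $a_i\in L^\infty(S^1)$ (complex-valued) for which there is $l>0$ (depending on $a$) with $\sup_{x\in S^1}|a_i(x)|\le l^i$ for all $i\ge1$ (sup understood as the $L^\infty$-norm). For $a,b\in X$: $a*b=(a_1*b_1,a_2*b_2,\dots)\in X$ and $a^{-1}=(a_1^{-1},a_2^{-1},\dots)\in X$, where $(a_i*b_i)(t)=2a_i(2t)$ for $0<t\le\pi$, $(a_i*b_i)(t)=2b_i(2t-2\pi)$ for $\pi<t\le2\pi$, and $a_i^{-1}(t)=-a_i(2\pi-t)$ for $0<t\le2\pi$ (extended $2\pi$-periodically). Basic iterated integrals on $X$: $I_{i_1,\dots,i_k}(a)=\int\cdots\int_{0\le s_1\le\cdots\le s_k\le2\pi}a_{i_k}(s_k)\cdots a_{i_1}(s_1)\,ds_k\cdots ds_1$. $\mathcal{U}\subset X$ is the set of $a$ at which all $I_{i_1,\dots,i_k}$ with $k\ge1$ vanish. The relation $a\sim b$ iff $a*b^{-1}\in\mathcal{U}$ is an equivalence relation; $G(X)$ is the set of classes $[a]$, a group under $[a]\cdot[b]=[a*b]$ with unit $[0]$. For $a\in X$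 and sufficiently small $r$ let $v(x;r;a)$, $x\in[0,2\pi]$, be the unique Lipschitz function satisfying $\frac{dv}{dx}=\sum_{i\ge1}a_i(x)v^{i+1}$ almost everywhere and $v(0;r;a)=r$. The first return map $P(a)(r):=v(2\pi;r;a)=r+\sum_{n\ge1}c_n(a)r^{n+1}$ depends only on $[a]$, and $\widehat P([a]):=P(a)$, $\widehat c_n([a]):=c_n(a)$. $G_c[[r]]$ is the set of complex power series $f(r)=r+\sum_{k\ge1}d_k(f)r^{k+1}$, each convergent near $0\in\mathbb{C}$, a group under composition, with product written in the order $f\cdot g:=g\circ f$; its topology $\tau'$ is the weakest in which all $d_k$ are continuous. $\widehat P$ is a homomorphism with kernel $\widehat{\mathcal{C}}$; $\pi:G(X)\to Q(X)$ is the quotient homomorphism. Each $\widehat c_n$ is constant on fibres of $\pi$ and defines $\overline c_n:Q(X)\to\mathbb{C}$ with $\overline c_n\circ\pi=\widehat c_n$; $\tau''$ is the weakest topology on $Q(X)$ in which all $\overline c_n$ are continuous. *)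

(* Defs.v *)
From HB Require Import structures.
From mathcomp Require Import all_boot all_order all_algebra.
From mathcomp Require Import all_classical all_reals all_analysis.
From mathcomp Require Import measurable_realfun ess_sup_inf complex.
From mathcomp Require Import ring.

Set Implicit Arguments.
Unset Strict Implicit.
Unset Printing Implicit Defensive.

Import Order.TTheory GRing.Theory Num.Theory.
Import numFieldNormedType.Exports.

Local Open Scope classical_set_scope.
Local Open Scope ring_scope.

(* R[i] seen as a numClosedFieldType, which gives it the topology of its
   norm. The norm `|z| takes its values in R[i]; normc z is the real modulus. *)
Definition CC (R : realType) : numClosedFieldType := complex R.

Definition reC (R : realType) (z : CC R) : R := complex.Re z.
Definition imC (R : realType) (z : CC R) : R := complex.Im z.
Definition realC (R : realType) (x : R) : CC R := Complex x 0.
Definition modC (R : realType) (z : CC R) : R := Normc.normc z.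

Definition intC (R : realType) (D : set R) (f : R -> CC R) : CC R :=
  Complex (\int[lebesgue_measure]_(t in D) reC (f t))
          (\int[lebesgue_measure]_(t in D) imC (f t)).

Definition twopi (R : realType) : R := 2 * pi.

(* A sequence (a_1, a_2, ...) is encoded with a n := a_{n+1}. The entries are
   functions rather than classes of functions modulo a.e. equality. By
   periodicity the essential supremum over the whole line is the L^oo norm on
   the circle. *)
Definition inX (R : realType) (a : nat -> R -> CC R) : Prop :=
  (forall n, [/\ forall t, a n (t + twopi R) = a n t,
                 measurable_fun setT (fun t => reC (a n t)) &
                 measurable_fun setT (fun t => imC (a n t))]) /\
  (exists2 l : R, 0 < l &
     forall n, (ess_sup (@lebesgue_measure R) (fun t => (modC (a n t))%:E)
                <= (l ^+ n.+1)%:E)%E).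

Record X (R : realType) := MkX { Xfun :> nat -> R -> CC R; XP : inX Xfun }.

(* The representative of t in ]0, 2 pi] modulo 2 pi. *)
Definition circ (R : realType) (t : R) : R :=
  t - twopi R * (Num.ceil (t / twopi R) - 1)%:~R.

Definition concat_fun (R : realType) (a b : nat -> R -> CC R) :
    nat -> R -> CC R :=
  fun n t => if circ t <= pi then 2 * a n (2 * circ t)
             else 2 * b n (2 * circ t - twopi R).

(* For a 2 pi-periodic a_i the formula on ]0, 2 pi] is already periodic. *)
Definition inv_fun (R : realType) (a : nat -> R -> CC R) : nat -> R -> CC R :=
  fun n t => - a n (twopi R - t).

Section closure.
Variable R : realType.
Implicit Types (a b : nat -> R -> CC R) (f g : R -> CC R).
Local Notation mu := (@lebesgue_measure R).

Lemma twopi_gt0 : 0 < twopi R.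
Proof. by rewrite mulr_gt0// pi_gt0. Qed.

Lemma null_affine (c d : R) (N : set R) : 0 < c -> mu.-negligible N ->
  mu.-negligible [set t | N (c * t + d)].
Proof.
move=> c0 [A [mA A0 NA]].
pose f : R -> measurableTypeR R := fun t => c * t + d.
have mf : measurable_fun [set: R] f.
  by apply: measurable_funD => //; exact: measurable_funM.
pose m : {measure set (measurableTypeR R) -> \bar R} :=
  mscale (NngNum (ltW c0))
   (@measure_function_pushforward__canonical__measure_function_Measure
      _ _ _ _ _ mu f mf).
have mE B : m B = (c%:E * mu (f @^-1` B))%E by [].
have E : mu A = (c%:E * mu (f @^-1` A))%E.
  rewrite -mE; apply: lebesgue_measure_unique => // _ [[x y]] _ <-.
  rewrite mE /=.
  have -> : f @^-1` `]x, y] = `](x - d) / c, (y - d) / c]%classic.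
    rewrite predeqE => t; rewrite /f /= !in_itv /=.
    rewrite ltr_pdivrMr// ler_pdivlMr// ltrBlDr lerBrDr.
    by rewrite [t * c]mulrC.
  rewrite !lebesgue_measure_itv/= !lte_fin ltr_pM2r ?invr_gt0// ltrD2r.
  case: ifPn => _; last by rewrite mule0.
  rewrite -!EFinB -EFinM; congr EFin.
  by rewrite -mulrBl opprB addrA subrK mulrC divfK// gt_eqF.
have mfA : measurable (f @^-1` A) by rewrite -[X in measurable X]setTI; exact: (mf).
exists (f @^-1` A); split => //; last by move=> t; apply: NA.
move/eqP: E; rewrite A0 eq_sym mule_eq0.
by rewrite eqe gt_eqF//= => /eqP.
Qed.

Lemma null_opp (N : set R) : mu.-negligible N ->
  mu.-negligible [set t | N (- t)].
Proof.
have mN : measurable_fun [set: R] (-%R : R -> R).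
  exact: (measurable_funN (@measurable_id _ R setT)).
move=> [A [mA A0 NA]]; exists (-%R @^-1` A); split.
- by rewrite -[X in measurable X]setTI; exact: mN.
- by have := lebesgue_measureN mA; rewrite A0.
- by move=> t; apply: NA.
Qed.

Lemma modCM2 (z : CC R) : modC (2 * z) = 2 * modC z.
Proof.
rewrite /modC Normc.normcM; congr (_ * _).
have -> : (2 : CC R) = realC (2 : R) by rewrite /realC -[RHS]/(2%:C)%C rmorph_nat.
by rewrite /= expr0n /= addr0 sqrtr_sqr ger0_norm.
Qed.

Lemma modC_ge0 (z : CC R) : 0 <= modC z.
Proof. by case: z => x y; exact: sqrtr_ge0. Qed.

Lemma re2 (z : CC R) : reC (2 * z) = 2 * reC z.
Proof. by rewrite !mulr_natl /reC !mulr2n; case: z. Qed.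

Lemma im2 (z : CC R) : imC (2 * z) = 2 * imC z.
Proof. by rewrite !mulr_natl /imC !mulr2n; case: z. Qed.

Lemma circD (t : R) : circ (t + twopi R) = circ t.
Proof.
have p0 := twopi_gt0; rewrite /circ mulrDl divff ?gt_eqF//.
rewrite ceilDrz ?int_num1// ceil1 addrK intrB.
by rewrite mulrBr mulr1; ring.
Qed.

Lemma periodic_int f (k : int) t : (forall s, f (s + twopi R) = f s) ->
  f (t + twopi R * k%:~R) = f t.
Proof.
move=> fp.
have P (m : nat) s : f (s + twopi R * m%:R) = f s.
  elim: m s => [|m IH] s; first by rewrite mulr0 addr0.
  by rewrite -natr1 mulrDr mulr1 addrA fp.
case: k => m; first by rewrite -pmulrn.
rewrite -(P m.+1 (t + _)) NegzE mulrNz mulrN -addrA.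
by rewrite -pmulrn addNr addr0.
Qed.

Lemma concat_funE a b n t :
  (forall s, a n (s + twopi R) = a n s) ->
  (forall s, b n (s + twopi R) = b n s) ->
  concat_fun a b n t =
    if circ t <= pi then 2 * a n (2 * t) else 2 * b n (2 * t).
Proof.
move=> ap bp; rewrite /concat_fun; case: ifP => _; congr (2 * _).
  rewrite -[RHS](@periodic_int _ (- (2 * (Num.ceil (t / twopi R) - 1))))//.
  by congr (a n _); rewrite /circ; ring.
rewrite -[RHS](@periodic_int _ (- (2 * (Num.ceil (t / twopi R) - 1)) - 1))//.
by congr (b n _); rewrite /circ; ring.
Qed.

Lemma measurable_circ : measurable_fun [set: R] (@circ R).
Proof.
apply: measurable_funB => //; apply: measurable_funM => //.
apply: nondecreasing_measurable => // x y xy.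
rewrite ler_int lerD2r le_ceil// ler_pM2r// invr_gt0; exact: twopi_gt0.
Qed.

Lemma inX_concat a b : inX a -> inX b -> inX (concat_fun a b).
Proof.
move=> [ha [l l0 la]] [hb [k k0 kb]]; split.
  move=> n; have [ap ar ai] := ha n; have [bp br bi] := hb n.
  have m2 : measurable_fun [set: R] (fun t : R => 2 * t).
    exact: measurable_funM.
  have mc : measurable_fun [set: R] (fun t : R => circ t <= pi).
    by apply: measurable_fun_ler => //; exact: measurable_circ.
  have T (h h' : R -> R) : measurable_fun setT h -> measurable_fun setT h' ->
      measurable_fun setT
        (fun t => if circ t <= pi then 2 * h (2 * t) else 2 * h' (2 * t)).
    move=> mh mh'; apply: measurable_fun_ifT => //.
      by apply: measurable_funM => //; exact: (measurableT_comp mh m2).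
    by apply: measurable_funM => //; exact: (measurableT_comp mh' m2).
  split.
  - by move=> t; rewrite /concat_fun circD.
  - rewrite [X in measurable_fun _ X](_ : _ = fun t => if circ t <= pi
      then 2 * reC (a n (2 * t)) else 2 * reC (b n (2 * t))).
      exact: (T (fun t => reC (a n t)) (fun t => reC (b n t))).
    by apply/funext => t; rewrite concat_funE//; case: ifP; rewrite re2.
  - rewrite [X in measurable_fun _ X](_ : _ = fun t => if circ t <= pi
      then 2 * imC (a n (2 * t)) else 2 * imC (b n (2 * t))).
      exact: (T (fun t => imC (a n t)) (fun t => imC (b n t))).
    by apply/funext => t; rewrite concat_funE//; case: ifP; rewrite im2.
have lk0 : 0 < l + k by rewrite addr_gt0.
exists (2 * (l + k)); first by rewrite mulr_gt0.
move=> n; apply/ess_supP.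
have [ap _ _] := ha n; have [bp _ _] := hb n.
have /ess_supP An := la n; have /ess_supP Bn := kb n.
have := negligibleU (@null_affine 2 0 _ (ltr0Sn _ _) An)
  (@null_affine 2 0 _ (ltr0Sn _ _) Bn).
apply: negligibleS => t /= bad.
apply: contrapT => /not_orP[]; rewrite addr0 => /contrapT Ha /contrapT Hb.
apply: bad; rewrite lee_fin concat_funE//.
have le2 : (2 : R) <= 2 ^+ n.+1 by rewrite exprS ler_peMr// exprn_ege1// ler1n.
move: Ha Hb; rewrite !lee_fin => Ha Hb.
have bound (z : R) (c : R) : 0 <= z -> 0 < c -> c <= l + k ->
    z <= c ^+ n.+1 -> 2 * z <= (2 * (l + k)) ^+ n.+1.
  move=> z0 c0 clk zc; rewrite exprMn ler_pM// (le_trans zc)//.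
  by rewrite lerXn2r// nnegrE ltW.
case: ifP => _; rewrite modCM2.
  by apply: (bound _ l) => //; rewrite ?modC_ge0// lerDl ltW.
by apply: (bound _ k) => //; rewrite ?modC_ge0// lerDr ltW.
Qed.

Lemma inX_inv a : inX a -> inX (inv_fun a).
Proof.
move=> [ha [l l0 la]]; split.
  move=> n; have [ap ar ai] := ha n.
  have mr : measurable_fun [set: R] (fun t : R => twopi R - t).
    exact: measurable_funB.
  split.
  - by move=> t; rewrite /inv_fun -[in LHS]ap; congr (- a n _); ring.
  - rewrite [X in measurable_fun _ X](_ : _ =
      fun t => - reC (a n (twopi R - t))).
      by apply: measurableT_comp => //; exact: (measurableT_comp ar mr).
    by apply/funext => t; rewrite /inv_fun /reC; case: (a n _).
  - rewrite [X in measurable_fun _ X](_ : _ =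
      fun t => - imC (a n (twopi R - t))).
      by apply: measurableT_comp => //; exact: (measurableT_comp ai mr).
    by apply/funext => t; rewrite /inv_fun /imC; case: (a n _).
exists l => // n; apply/ess_supP; have /ess_supP An := la n.
have := null_opp (@null_affine 1 (twopi R) _ ltr01 An).
apply: negligibleS => t /= bad H; apply: bad; move: H.
by rewrite mul1r addrC /inv_fun /modC normcN.
Qed.

Lemma inX_zero : inX (fun (_ : nat) (_ : R) => 0 : CC R).
Proof.
split; first by move=> n; split => //; exact: measurable_cst.
exists 1 => // n; apply/ess_supP; apply: nearW => t.
by rewrite /modC Normc.normc0 lee_fin exprn_ge0.
Qed.

End closure.

Definition concatX (R : realType) (a b : X R) : X R :=
  MkX (inX_concat (XP a) (XP b)).
Definition invX (R : realType) (a : X R) : X R := MkX (inX_inv (XP a)).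
Definition zeroX (R : realType) : X R := MkX (@inX_zero R).

(* The word [:: i_1; ...; i_k] (zero-based indices) and s stand for the integral
   over s <= s_1 <= ... <= s_k <= 2 pi, iterated in the order ds_k ... ds_1. *)
Fixpoint iter_int (R : realType) (a : nat -> R -> CC R) (w : seq nat) (s : R) :
    CC R :=
  if w is i :: w' then
    intC `[s, twopi R] (fun t => a i t * iter_int a w' t)
  else 1.

Definition basic_int (R : realType) (w : seq nat) (a : X R) : CC R :=
  iter_int a w 0.

Definition UX (R : realType) : set (X R) :=
  [set a | forall w, w != [::] -> basic_int w a = 0].

Definition simX (R : realType) (a b : X R) : Prop := UX (concatX a (invX b)).

(* The set { cl x | x : T } as a subtype of set T. Operations on classes are
   computed on chosen representatives; cl (class_rep A) = A as sets. *)
Definition classes (T : Type) (cl : T -> set T) : choiceType :=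
  set_type (range cl).

Definition mk_class (T : Type) (cl : T -> set T) (x : T) : classes cl :=
  exist _ (cl x) (mem_set (imageT cl x)).

Definition class_rep (T : Type) (cl : T -> set T) (A : classes cl) : T :=
  s2val (cid2 (set_mem (valP A))).

Definition simclass (R : realType) (a : X R) : set (X R) := [set b | simX a b].
Definition GX (R : realType) : choiceType := classes (@simclass R).
Definition toG (R : realType) (a : X R) : GX R := mk_class _ a.
Definition mulG (R : realType) (A B : GX R) : GX R :=
  toG (concatX (class_rep A) (class_rep B)).
Definition invG (R : realType) (A : GX R) : GX R := toG (invX (class_rep A)).
Definition oneG (R : realType) : GX R := toG (zeroX R).

Definition weakest_topology (T : choiceType) (U : topologicalType)
    (f : nat -> T -> U) : topologicalType :=
  sup_topology (fun n => Topological.class (initial_topology (f n))).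

(* f(r) = r + sum_{k >= 1} d_k r^{k+1} is encoded with d n := d_{n+1}. *)
Definition ps_terms (R : realType) (d : nat -> CC R) (z : CC R) : nat -> CC R :=
  fun n => d n * z ^+ n.+2.

Definition convergent_ps (R : realType) : set (nat -> CC R) :=
  [set d | \forall z \near (0 : CC R), cvgn (series (ps_terms d z))].

Definition Gcset (R : realType) : choiceType := set_type (@convergent_ps R).

Definition coefGc (R : realType) (n : nat) (f : Gcset R) : CC R := val f n.

Definition Gc (R : realType) : topologicalType :=
  weakest_topology (@coefGc R).

Definition evalGc (R : realType) (f : Gc R) (z : CC R) : CC R :=
  z + limn (series (ps_terms (val (f : Gcset R)) z)).

Lemma convergent_ps0 (R : realType) : convergent_ps (fun=> 0 : CC R).
Proof.
near=> z; rewrite (_ : series _ = cst 0); first exact: is_cvg_cst.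
by apply/funext => n; rewrite /series /= big1// => i _; rewrite /ps_terms mul0r.
Unshelve. all: by end_near. Qed.

Definition oneGc (R : realType) : Gc R :=
  (exist (fun d => d \in @convergent_ps R) _ (mem_set (@convergent_ps0 R))
    : Gcset R).

(* The product f . g is the composite g o f, characterized by its germ at 0. *)
Definition mulGc (R : realType) (f g : Gc R) : Gc R :=
  xget (oneGc R)
    [set h : Gc R | \forall z \near (0 : CC R), evalGc h z = evalGc g (evalGc f z)].

(* Only the values of v on [0, 2 pi] matter. Convergence of the series is part
   of the a.e. requirement, and the derivative is taken componentwise. *)
Definition ode_solution (R : realType) (a : X R) (r : CC R) (v : R -> CC R) :
    Prop :=
  [/\ v 0 = r,
      (exists k : R, forall x y, x \in `[0, twopi R] -> y \in `[0, twopi R] ->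
         modC (v x - v y) <= k * `|x - y|) &
      {ae @lebesgue_measure R, forall x, x \in `]0, twopi R[ ->
         exists s : CC R,
           [/\ series (fun n => a n x * v x ^+ n.+2) @ \oo --> s,
               is_derive x 1 (fun t => reC (v t)) (reC s) &
               is_derive x 1 (fun t => imC (v t)) (imC s)]}].

(* v(x; r; a) for x in [0, 2 pi] and small r; unspecified otherwise. *)
Definition ode_flow (R : realType) (x : R) (r : CC R) (a : X R) : CC R :=
  xget (cst 0) (ode_solution a r) x.

Definition first_return (R : realType) (a : X R) : Gc R :=
  xget (oneGc R)
    [set f : Gc R | \forall r \near (0 : CC R),
                      ode_flow (twopi R) r a = evalGc f r].

Definition Phat (R : realType) (A : GX R) : Gc R := first_return (class_rep A).

Definition chat (R : realType) (n : nat) (A : GX R) : CC R :=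
  coefGc n (Phat A : Gcset R).

Definition kerP (R : realType) : set (GX R) := [set A | Phat A = oneGc R].

Definition coset (R : realType) (A : GX R) : set (GX R) :=
  [set mulG A K | K in @kerP R].

Definition QXset (R : realType) : choiceType := classes (@coset R).

Definition cbar (R : realType) (n : nat) (q : QXset R) : CC R :=
  chat n (class_rep q).

Definition QX (R : realType) : topologicalType := weakest_topology (@cbar R).

Definition piQ (R : realType) (A : GX R) : QX R := (mk_class _ A : QXset R).
Definition reprQ (R : realType) (q : QX R) : GX R := class_rep (q : QXset R).
Definition mulQ (R : realType) (p q : QX R) : QX R :=
  piQ (mulG (reprQ p) (reprQ q)).
Definition invQ (R : realType) (q : QX R) : QX R := piQ (invG (reprQ q)).
Definition oneQ (R : realType) : QX R := piQ (oneG R).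

Definition is_group (T : Type) (mul : T -> T -> T) (one : T) (inv : T -> T) :
    Prop :=
  [/\ associative mul, left_id one mul, right_id one mul,
      left_inverse one inv mul & right_inverse one inv mul].

Definition is_topological_group (T : topologicalType) (mul : T -> T -> T)
    (one : T) (inv : T -> T) : Prop :=
  [/\ is_group mul one inv, continuous (fun p : T * T => mul p.1 p.2) &
      continuous inv].

Definition is_topological_group_iso (T U : topologicalType)
    (mulT : T -> T -> T) (mulU : U -> U -> U) (f : T -> U) : Prop :=
  {morph f : x y / mulT x y >-> mulU x y} /\
  exists g : U -> T,
    [/\ cancel f g, cancel g f, continuous f & continuous g].

(* Main.v *)
Require Import Defs.
From mathcomp Require Import all_boot all_order all_algebra.
From mathcomp Require Import all_classical all_reals all_analysis.
From mathcomp Require Import measurable_realfun ess_sup_inf complex.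
From mathcomp Require Import ring lra.

Set Implicit Arguments.
Unset Strict Implicit.
Unset Printing Implicit Defensive.

Import Order.TTheory GRing.Theory Num.Theory.
Import numFieldNormedType.Exports.

Local Open Scope classical_set_scope.
Local Open Scope ring_scope.

(** The first return map turns concatenation of paths into composition.  Three
    facts then give the theorem: it is onto, its fibres are the cosets of its
    kernel, and the coefficients of composites and inverses of series depend
    continuously on the coefficients of the factors.

    The first return map through iterated integrals.  Let Phi(s, r) be the value
    at time 2 pi of the solution that equals r at time s.  It solves the linear
    transport equation Phi_s + (sum_i a_i(s) r^(i+1)) Phi_r = 0 with
    Phi(2 pi, r) = r, so its coefficients are obtained by successive integrations:
    they are fixed linear combinations of iterated integrals ([flow_coef]).
    Along a solution v the function Phi(x, v(x)) is constant, whence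
    v(2 pi) = Phi(0, r) ([ode_expansion]); solutions with small initial value
    exist by Picard iteration ([ode_exists]).  Hence the first return map is the
    power series with coefficients [flow_coef a n.+1 0]
    ([first_return_series]), it depends only on the iterated integrals of a,
    and gluing solutions gives its multiplicativity ([first_return_concat]).

    The group of paths.  Chen's formula ([basic_int_concat]) makes the family of
    all iterated integrals multiplicative for the deconcatenation product, with
    the integrals of the inverse path as inverse ([basic_int_concat_inv]).
    Therefore two paths are equivalent exactly when their iterated integrals
    agree ([simX_basic_int]), and the cosets of the kernel are the fibres of the
    first return map ([cosetE]).

    Surjectivity.  Given f, prescribe Phi(s, r) = r + (1 - s / 2 pi) (f(r) - r).
    The transport equation then determines the coefficients a_i by a linear
    triangular recursion with geometric bounds ([field_coef_le]), and the path
    obtained has first return map f ([first_return_section]).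

    Continuity.  The a_i just found are polynomials in 1 - s / 2 pi whose
    coefficients depend continuously on f, and such families are stable under
    products and integration; so the iterated integrals of the path attached to
    f are continuous in f ([continuous_basic_int]), and so are those of its
    inverse.  Chen's formula then gives the continuity of products and inverses.

    Integrals are handled through Lipschitz functions with a prescribed a.e.
    derivative ([primitive]): identities between iterated integrals are proved
    by differentiating both sides ([primitive_unique]) and estimates by
    comparing derivatives ([primitive_growth]). *)

(** * Complex numbers *)

Section Modulus.
Variable R : realType.
Implicit Types (z w : CC R) (x y : R).

Lemma reCD z w : reC (z + w) = reC z + reC w.
Proof. by case: z w => [? ?] [? ?]. Qed.
Lemma imCD z w : imC (z + w) = imC z + imC w.
Proof. by case: z w => [? ?] [? ?]. Qed.
Lemma reCN z : reC (- z) = - reC z. Proof. by case: z. Qed.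
Lemma imCN z : imC (- z) = - imC z. Proof. by case: z. Qed.
Lemma reCM z w : reC (z * w) = reC z * reC w - imC z * imC w.
Proof. by case: z w => [? ?] [? ?]. Qed.
Lemma imCM z w : imC (z * w) = reC z * imC w + imC z * reC w.
Proof. by case: z w => [? ?] [? ?]. Qed.
Lemma reim_eq z w : reC z = reC w -> imC z = imC w -> z = w.
Proof. by case: z w => [? ?] [? ?] /= -> ->. Qed.

Lemma realCD x y : realC (x + y) = realC x + realC y.
Proof. by apply: reim_eq; rewrite ?reCD ?imCD //= addr0. Qed.
Lemma realCN x : realC (- x) = - realC x.
Proof. by apply: reim_eq; rewrite ?reCN ?imCN //= oppr0. Qed.
Lemma realCM x y : realC (x * y) = realC x * realC y.
Proof. by apply: reim_eq; rewrite ?reCM ?imCM //= ?(mulr0, mul0r, addr0, subr0). Qed.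
Lemma realC1 : realC 1 = 1 :> CC R. Proof. by []. Qed.
Lemma realC_nat n : realC n%:R = n%:R :> CC R.
Proof. by elim: n => // n IH; rewrite -addn1 !natrD realCD IH. Qed.
Lemma realCX x n : realC (x ^+ n) = realC x ^+ n.
Proof. by elim: n => // n IH; rewrite !exprS realCM IH. Qed.

Lemma normCE z : `|z| = realC (modC z). Proof. by []. Qed.
Lemma realC_lt x y : (realC x < realC y) = (x < y).
Proof. by rewrite /realC ltcE /= eqxx. Qed.

Lemma modC0 : modC (0 : CC R) = 0. Proof. exact: Normc.normc0. Qed.
Lemma modC1 : modC (1 : CC R) = 1. Proof. exact: Normc.normc1. Qed.
Lemma modCN z : modC (- z) = modC z. Proof. exact: normcN. Qed.
Lemma modCM z w : modC (z * w) = modC z * modC w.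
Proof. exact: Normc.normcM. Qed.
Lemma modCD z w : modC (z + w) <= modC z + modC w.
Proof. exact: le_normcD. Qed.
Lemma modC_dist z w : modC (z - w) = modC (w - z).
Proof. by rewrite -modCN opprB. Qed.
Lemma modCB z w : modC (z - w) <= modC z + modC w.
Proof. by rewrite -(modCN w) modCD. Qed.
Lemma modC_eq0 z : modC z = 0 -> z = 0.
Proof. exact: Normc.eq0_normc. Qed.
Lemma modCX z n : modC (z ^+ n) = modC z ^+ n.
Proof. by elim: n => [|n IH]; rewrite ?modC1// !exprS modCM IH. Qed.
Lemma modC_realC x : modC (realC x) = `|x|.
Proof. by rewrite /modC /= expr0n /= addr0 sqrtr_sqr. Qed.
Lemma modC_nat n : modC (n%:R : CC R) = n%:R.
Proof. by rewrite -realC_nat modC_realC ger0_norm. Qed.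
Lemma modC_sum (I : Type) (s : seq I) (P : pred I) (F : I -> CC R) :
  modC (\sum_(i <- s | P i) F i) <= \sum_(i <- s | P i) modC (F i).
Proof.
elim/big_rec2: _ => [|i y x _ H]; first by rewrite modC0.
by rewrite (le_trans (modCD _ _))// lerD2l.
Qed.
Lemma modC_sqr z : modC z ^+ 2 = reC z ^+ 2 + imC z ^+ 2.
Proof. by case: z => a b; rewrite /modC /= sqr_sqrtr// addr_ge0// sqr_ge0. Qed.
Lemma re_le_mod z : `|reC z| <= modC z.
Proof.
rewrite -(ler_pXn2r (n := 2))// ?nnegrE ?modC_ge0// modC_sqr.
by rewrite real_normK ?num_real// lerDl sqr_ge0.
Qed.
Lemma im_le_mod z : `|imC z| <= modC z.
Proof.
rewrite -(ler_pXn2r (n := 2))// ?nnegrE ?modC_ge0// modC_sqr.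
by rewrite real_normK ?num_real// lerDr sqr_ge0.
Qed.
Lemma mod_le_reim z : modC z <= `|reC z| + `|imC z|.
Proof.
rewrite -(ler_pXn2r (n := 2))// ?nnegrE ?modC_ge0//.
rewrite modC_sqr sqrrD !real_normK ?num_real// lerD2r lerDl.
by rewrite mulrn_wge0// mulr_ge0.
Qed.

End Modulus.

(** * Lipschitz functions and their almost everywhere derivatives *)

Section Monotone.
Variable R : realType.
Local Notation mu := (@lebesgue_measure R).
Implicit Types (p q x y : R) (f : R -> R).

(** The derivative says nothing on a null set.  That set is covered by an open
    set O of measure less than e; the increase of f is bounded by slope e outside
    O, and inside O by k times the measure psi of the part of O already crossed.
    A supremum argument carries this estimate from p to q. *)
Lemma lip_nonincreasing p q f k : p <= q ->
  (forall x y, x \in `[p, q] -> y \in `[p, q] -> `|f x - f y| <= k * `|x - y|) ->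
  {ae mu, forall x, x \in `]p, q[ ->
     exists2 d, is_derive x 1 f d & d <= 0} ->
  f q <= f p.
Proof.
move=> pq lipf.
have k0 : 0 <= `|k| by [].
have {}lipf x y : x \in `[p, q] -> y \in `[p, q] ->
    `|f x - f y| <= `|k| * `|x - y|.
  move=> xp yp; apply: le_trans (lipf _ _ xp yp) _.
  by rewrite ler_wpM2r// ler_norm.
move=> [A [mA A0 badA]].
(* The end point p joins the exceptional set, since the derivative is known
   only inside the interval. *)
have mA' : measurable (A `|` [set p] : set R) by exact: measurableU.
have A'0 : mu (A `|` [set p]) = 0%E.
  apply/eqP; rewrite eq_le measure_ge0 andbT.
  have : (mu (A `|` [set p]) <= mu A + mu [set p])%E by exact: measureU2.
  by rewrite (A0 : mu A = 0%E) lebesgue_measure_set1 adde0.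
suff H e : 0 < e -> f q - f p <= (`|k| + (q - p)) * e.
  rewrite -subr_le0; apply/ler_addgt0Pr => e e0; rewrite add0r.
  have K0 : 0 < `|k| + (q - p) + 1 by rewrite ltr_wpDl// addr_ge0// subr_ge0.
  apply: le_trans (H (e / (`|k| + (q - p) + 1)) _) _; first by rewrite divr_gt0.
  rewrite mulrCA ler_piMr ?(ltW e0)// ler_pdivrMr// mul1r lerDl//.
move=> e0.
have [|O [oO AO muO]] := lebesgue_regularity_outer mA' _ e0.
  by suff : (mu (A `|` [set p]) < +oo)%E; [|rewrite A'0].
have {}muO : (mu O < e%:E)%E.
  apply: le_lt_trans muO.
  have -> : O = (A `|` [set p]) `|` (O `\` (A `|` [set p])).
    by rewrite setDUK.
  have mD : measurable (O `\` (A `|` [set p])).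
    by apply: measurableD => //; exact: open_measurable.
  have := measureU2 mu mA' mD; rewrite [X in (_ <= X + _)%E]A'0 add0e.
  move=> /le_trans; apply; apply: le_measure; rewrite ?inE.
  - by apply: measurableD => //; exact: open_measurable.
  - apply: measurableD => //; rewrite setDUK//; exact: open_measurable.
  - by rewrite setDUK.
pose psi x := fine (mu (O `&` `[p, x])).
have mO : measurable O by exact: open_measurable.
have mOx x : measurable (O `&` `[p, x]) by apply: measurableI.
have psiE x : (mu (O `&` `[p, x]) = (psi x)%:E)%E.
  rewrite fineK// ge0_fin_numE//; apply: le_lt_trans (lt_trans muO (ltry _)).
  by apply: le_measure; [rewrite inE; exact: mOx|rewrite inE|exact: subIsetl].
have psi_le x : psi x <= e.
  rewrite -lee_fin -psiE; apply: le_trans (ltW muO).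
  by apply: le_measure; [rewrite inE; exact: mOx|rewrite inE|exact: subIsetl].
have psi_ge0 x : 0 <= psi x by rewrite fine_ge0.
have psi_mono x y : x <= y -> psi x <= psi y.
  move=> xy; rewrite -lee_fin -!psiE.
  apply: le_measure; [rewrite inE; exact: mOx|rewrite inE; exact: mOx|].
  apply: setIS; by apply: subset_itvl; rewrite bnd_simp.
pose good x := f x - f p <= `|k| * psi x + e * (x - p).
suff : good q.
  move=> /le_trans; apply; rewrite mulrDl [e * _]mulrC lerD2r.
  by rewrite ler_wpM2l.
pose S := [set x | x \in `[p, q] /\ forall y, y \in `[p, x] -> good y].
have Sp : S p.
  split; first by rewrite bound_itvE.
  move=> y; rewrite in_itv /= => /andP[py yp].
  have -> : y = p by apply/eqP; rewrite eq_le py yp.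
  by rewrite /good !subrr mulr0 addr0 mulr_ge0.
have supS : has_sup S.
  split; first by exists p.
  by exists q => x [] /[!in_itv] /= /andP[].
set c := sup S.
have pc : p <= c by exact: ub_le_sup supS.2 _ Sp.
have cq : c <= q by apply: ge_sup => [|x [] /[!in_itv] /= /andP[]]; first exact: supS.1.
have cpq : c \in `[p, q] by rewrite in_itv /= pc cq.
have ltc y : p <= y -> y < c -> good y.
  move=> py yc.
  have [|z [zS Sz] yz] := sup_adherent (eps := c - y) _ supS; first by rewrite subr_gt0.
  by apply: Sz; rewrite in_itv /= py /=; move: yz; rewrite opprB addrC subrK => /ltW.
have goodc : good c.
  move: pc; rewrite le_eqVlt => /predU1P[<-|pc].
    by apply: Sp.2; rewrite bound_itvE.
  rewrite /good; apply/ler_addgt0Pr => d d0.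
  pose y := Num.max p (c - d / (`|k| + 1)).
  have K0 : 0 < `|k| + 1 by rewrite ltr_wpDl.
  have py : p <= y by rewrite le_max lexx.
  have yc : y < c by rewrite gt_max pc /= ltrBlDr ltrDl divr_gt0.
  have ypq : y \in `[p, q] by rewrite in_itv /= py (le_trans (ltW yc)).
  have := ltc _ py yc; rewrite /good => gy.
  have := lipf _ _ cpq ypq; rewrite (gtr0_norm (x := c - y)) ?subr_gt0// => ly.
  have cy : c - y <= d / (`|k| + 1).
    by rewrite lerBlDr -lerBlDl le_max lexx orbT.
  have kd : `|k| * (c - y) <= d.
    apply: le_trans (_ : `|k| * (d / (`|k| + 1)) <= _).
      by rewrite ler_wpM2l.
    rewrite mulrCA ler_piMr ?(ltW d0)// ler_pdivrMr// mul1r lerDl//.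
  have := ler_norm (f c - f y).
  have : `|k| * psi y <= `|k| * psi c by rewrite ler_wpM2l// psi_mono// ltW.
  have : e * (y - p) <= e * (c - p) by rewrite ler_pM2l// lerD2r ltW.
  by move: (`|k| * (c - y)) kd ly => K; lra.
suff : c = q by move=> <-.
apply/eqP; rewrite eq_le cq /= leNgt; apply/negP => {}cq.
suff [d d0 Hd] : exists2 d, 0 < d & forall y, c < y -> y < c + d -> y <= q -> good y.
  pose y := Num.min q (c + d / 2).
  have cy : c < y by rewrite lt_min cq ltrDl divr_gt0.
  have : S y.
    split; first by rewrite in_itv /= (le_trans pc (ltW cy))//= ge_min lexx.
    move=> z; rewrite in_itv /= => /andP[pz zy].
    have [zc|cz|->//] := ltgtP z c; first exact: ltc.
    apply: Hd => //.
      apply: (le_lt_trans zy); rewrite gt_min; apply/orP; right.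
      by rewrite ltrD2l ltr_pdivrMr// ltr_pMr// ltr1n.
    by apply: (le_trans zy); rewrite ge_min lexx.
  by move/(ub_le_sup supS.2); rewrite leNgt cy.
have [Oc|nOc] := pselect (O c).
  (* Inside the cover psi grows with slope 1. *)
  have /nbhs_ballP[d /= d0 Hd] : nbhs c O by exact: open_nbhs_nbhs.
  exists d => // y cy yd yq.
  have ypq : y \in `[p, q] by rewrite in_itv /= (le_trans pc (ltW cy)).
  have psiy : psi c + (y - c) <= psi y.
    rewrite -lee_fin EFinD -!psiE.
    have -> : (y - c)%:E = mu (`]c, y]%classic : set R).
      by rewrite lebesgue_measure_itv /= lte_fin cy.
    have <- : mu ((O `&` `[p, c]) `|` `]c, y]) =
        (mu (O `&` `[p, c]) + mu `]c, y]%classic)%E.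
      apply: measureU; [exact: mOx|exact: measurable_itv|].
      rewrite -subset0 => z [[_ /=]].
      rewrite !in_itv /= => /andP[_ zc] /andP[cz _].
      by move: (le_lt_trans zc cz); rewrite ltxx.
    apply: le_measure; [rewrite inE|rewrite inE; exact: mOx|].
      by apply: measurableU; [exact: mOx|exact: measurable_itv].
    move=> z [[Oz /=]|/=]; rewrite !in_itv /= => /andP[h1 h2].
      split; [exact: Oz|apply/andP; split; first exact: h1].
      exact: (le_trans h2 (ltW cy)).
    split; last by apply/andP; split; [exact: (le_trans pc (ltW h1))|exact: h2].
    by apply: Hd; rewrite /ball /= ltr0_norm ?subr_lt0//; lra.
  have := lipf _ _ ypq cpq; rewrite (gtr0_norm (x := y - c)) ?subr_gt0// => ly.
  have := ler_norm (f y - f c).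
  have : `|k| * psi c + `|k| * (y - c) <= `|k| * psi y.
    by rewrite -mulrDr ler_wpM2l.
  have : e * (c - p) <= e * (y - p) by rewrite ler_pM2l// lerD2r ltW.
  move: goodc ly; rewrite /good.
  by move: (`|k| * (y - c)) => K; lra.
have {}pc : p < c.
  rewrite lt_neqAle pc andbT; apply/eqP => pc'.
  by apply: nOc; apply: AO; right; rewrite pc'.
have cpq' : c \in `]p, q[ by rewrite in_itv /= pc cq.
have [d [fd dE] d0] : exists2 d, is_derive c 1 f d & d <= 0.
  apply: contrapT => nd; apply: nOc; apply: AO; left; apply: badA => /=.
  by move/(_ cpq').
move/cvg_ex: (fd) => [/= l fl].
have ld : l = d by rewrite -dE; apply/esym/cvg_lim.
move/cvgrPdist_lt : fl => /(_ _ e0) /nbhs_ballP [r /= r0 Hr].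
exists r => // y cy yr yq.
have := Hr (y - c); rewrite /ball /= sub0r normrN gtr0_norm ?subr_gt0//.
move=> /(_ ltac:(lra)); rewrite subr_eq0 gt_eqF// => /(_ isT).
rewrite -[(y - c) *: 1]/((y - c) * 1) mulr1 subrK -[_ *: _]/((y - c)^-1 * _).
have yc0 : 0 < y - c by rewrite subr_gt0.
rewrite distrC => /(le_lt_trans (ler_norm _)).
rewrite ld ltrBlDr mulrC ltr_pdivrMr// => fy.
have fy' : f y - f c <= e * (y - c).
  by apply: le_trans (ltW fy) _; rewrite ler_pM2r// gerDl.
have : `|k| * psi c <= `|k| * psi y by rewrite ler_wpM2l// psi_mono// ltW.
move: goodc; rewrite /good.
rewrite (_ : e * (y - p) = e * (c - p) + e * (y - c)); last by ring.
by lra.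
Qed.

End Monotone.

Section Primitive.
Variable R : realType.
Local Notation mu := (@lebesgue_measure R).
Implicit Types (p q x y : R) (f g h : R -> CC R).

Lemma aeS (P Q : R -> Prop) : (forall x, P x -> Q x) ->
  {ae mu, forall x, P x} -> {ae mu, forall x, Q x}.
Proof. by apply: filterS; exact: (ae_filter_ringOfSetsType mu). Qed.

Lemma aeS2 (P Q S : R -> Prop) : (forall x, P x -> Q x -> S x) ->
  {ae mu, forall x, P x} -> {ae mu, forall x, Q x} -> {ae mu, forall x, S x}.
Proof. by apply: filterS2; exact: (ae_filter_ringOfSetsType mu). Qed.

Lemma aeS3 (P Q S T : R -> Prop) : (forall x, P x -> Q x -> S x -> T x) ->
  {ae mu, forall x, P x} -> {ae mu, forall x, Q x} ->
  {ae mu, forall x, S x} -> {ae mu, forall x, T x}.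
Proof. by apply: filterS3; exact: (ae_filter_ringOfSetsType mu). Qed.

Lemma ae_neq (m : R) : {ae mu, forall x : R, x != m}.
Proof.
exists [set m]; split => //; first exact: lebesgue_measure_set1.
by move=> x /= /negP; rewrite negbK => /eqP.
Qed.
(** Componentwise, as in the equation to be solved: [CC R] carries the norm of a
    module over itself, not over [R]. *)
Definition der g x (d : CC R) : Prop :=
  is_derive x 1 (fun t => reC (g t)) (reC d) /\
  is_derive x 1 (fun t => imC (g t)) (imC d).

Lemma der_cst c x : der (fun=> c) x 0.
Proof. by split; exact: is_derive_cst. Qed.

Lemma derD g1 g2 x d1 d2 : der g1 x d1 -> der g2 x d2 ->
  der (fun t => g1 t + g2 t) x (d1 + d2).
Proof.
move=> [r1 i1] [r2 i2]; split.
  rewrite reCD; under [X in is_derive _ _ X]funext do rewrite reCD.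
  exact: is_deriveD.
rewrite imCD; under [X in is_derive _ _ X]funext do rewrite imCD.
exact: is_deriveD.
Qed.

Lemma derM g1 g2 x d1 d2 : der g1 x d1 -> der g2 x d2 ->
  der (fun t => g1 t * g2 t) x (d1 * g2 x + g1 x * d2).
Proof.
move=> [r1 i1] [r2 i2]; split.
  rewrite reCD !reCM; under [X in is_derive _ _ X]funext do rewrite reCM.
  refine (is_derive_eq (is_deriveB (is_deriveM r1 r2) (is_deriveM i1 i2)) _).
  by rewrite /GRing.scale /=; ring.
rewrite imCD !imCM; under [X in is_derive _ _ X]funext do rewrite imCM.
refine (is_derive_eq (is_deriveD (is_deriveM r1 i2) (is_deriveM i1 r2)) _).
by rewrite /GRing.scale /=; ring.
Qed.

Lemma der_affine g c e x d : der g (c * x + e) d ->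
  der (fun t => g (c * t + e)) x (realC c * d).
Proof.
have A : is_derive x 1 (fun t : R => c * t + e) c.
  refine (is_derive_eq (is_deriveD (is_deriveZ c (is_derive_id x 1))
    (is_derive_cst e x 1)) _).
  by rewrite addr0 -[_ *: _]/(c * 1) mulr1.
move=> [rg ig]; split.
  rewrite reCM /= mul0r subr0 mulrC.
  by apply: (@is_derive1_comp _ (fun t => reC (g t)) (fun t => c * t + e)).
rewrite imCM /= mul0r addr0 mulrC.
by apply: (@is_derive1_comp _ (fun t => imC (g t)) (fun t => c * t + e)).
Qed.

Lemma der_near g1 g2 x d : (\forall y \near x, g1 y = g2 y) ->
  der g1 x d -> der g2 x d.
Proof.
move=> e [r1 i1]; split.
- by apply: (near_eq_is_derive _ r1); near do congr reC.
- by apply: (near_eq_is_derive _ i1); near do congr imC.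
Unshelve. all: by end_near. Qed.

Definition lipC p q g := exists k : R, forall x y,
  x \in `[p, q] -> y \in `[p, q] -> modC (g x - g y) <= k * `|x - y|.

(** The indefinite integrals of bounded functions, characterized by their a.e.
    derivative.  In this form sums, products and affine substitutions are
    pointwise facts about derivatives. *)
Definition primitive p q g h : Prop :=
  lipC p q g /\ {ae mu, forall x, x \in `]p, q[ -> der g x (h x)}.

Lemma lipC_ge0 p q g : lipC p q g -> exists2 k, 0 <= k & forall x y,
  x \in `[p, q] -> y \in `[p, q] -> modC (g x - g y) <= k * `|x - y|.
Proof.
move=> [k kP]; exists `|k| => // x y xp yp.
by apply: le_trans (kP _ _ xp yp) _; rewrite ler_wpM2r// ler_norm.
Qed.

Lemma lipC_bounded p q g : lipC p q g ->
  exists2 M, 0 <= M & forall x, x \in `[p, q] -> modC (g x) <= M.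
Proof.
move=> /lipC_ge0 [k k0 kP].
exists (modC (g p) + k * `|q - p|); first by rewrite addr_ge0// ?modC_ge0// mulr_ge0.
move=> x xpq; have pq : p \in `[p, q].
  by move: xpq; rewrite !in_itv /= lexx => /andP[]; exact: le_trans.
rewrite -[g x](subrK (g p)) addrC; apply: le_trans (modCD _ _) _.
rewrite lerD2l; apply: le_trans (kP _ _ xpq pq) _; rewrite ler_wpM2l//.
move: xpq; rewrite in_itv /= => /andP[px xq].
by rewrite !ger0_norm ?subr_ge0// ?(le_trans px)// lerD2r.
Qed.

Lemma primitive_cst p q c : primitive p q (fun=> c) (fun=> 0).
Proof.
split; last by apply: aeW => x _; exact: der_cst.
by exists 0 => x y _ _; rewrite subrr modC0 mul0r.
Qed.

Lemma primitiveD p q g1 g2 h1 h2 :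
  primitive p q g1 h1 -> primitive p q g2 h2 ->
  primitive p q (fun x => g1 x + g2 x) (fun x => h1 x + h2 x).
Proof.
move=> [[k1 l1] d1] [[k2 l2] d2]; split.
  exists (k1 + k2) => x y xp yp; rewrite mulrDl opprD addrACA.
  by apply: le_trans (modCD _ _) _; rewrite lerD ?l1 ?l2.
by move: d1 d2; apply: aeS2 => x D1 D2 xpq; apply: derD; [exact: D1|exact: D2].
Qed.

Lemma primitiveM p q g1 g2 h1 h2 :
  primitive p q g1 h1 -> primitive p q g2 h2 ->
  primitive p q (fun x => g1 x * g2 x) (fun x => h1 x * g2 x + g1 x * h2 x).
Proof.
move=> [l1 d1] [l2 d2]; split.
  have [M1 M10 b1] := lipC_bounded l1; have [M2 M20 b2] := lipC_bounded l2.
  have [k1 k10 {}l1] := lipC_ge0 l1; have [k2 k20 {}l2] := lipC_ge0 l2.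
  exists (k1 * M2 + M1 * k2) => x y xp yp.
  have -> : g1 x * g2 x - g1 y * g2 y =
    (g1 x - g1 y) * g2 x + g1 y * (g2 x - g2 y) by ring.
  apply: le_trans (modCD _ _) _; rewrite !modCM mulrDl lerD//.
    by rewrite mulrAC ler_pM ?modC_ge0 ?l1 ?b2.
  by rewrite -mulrA ler_pM ?modC_ge0 ?l2 ?b1.
by move: d1 d2; apply: aeS2 => x D1 D2 xpq; apply: derM; [exact: D1|exact: D2].
Qed.

Lemma primitiveZ p q c g h :
  primitive p q g h -> primitive p q (fun x => c * g x) (fun x => c * h x).
Proof.
move=> /(primitiveM (primitive_cst p q c)); congr primitive.
by apply/funext => x; rewrite mul0r add0r.
Qed.

Lemma primitiveN p q g h :
  primitive p q g h -> primitive p q (fun x => - g x) (fun x => - h x).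
Proof.
move=> /(primitiveZ (-1)).
by under [X in primitive _ _ X]funext do rewrite mulN1r;
   under [X in primitive _ _ _ X]funext do rewrite mulN1r.
Qed.

Lemma primitive_sum (I : Type) (s : seq I) p q (G H : I -> R -> CC R) :
  (forall i, primitive p q (G i) (H i)) ->
  primitive p q (fun x => \sum_(i <- s) G i x) (fun x => \sum_(i <- s) H i x).
Proof.
move=> GH; elim: s => [|i s IH].
  under [X in primitive _ _ X]funext do rewrite big_nil.
  under [X in primitive _ _ _ X]funext do rewrite big_nil.
  exact: primitive_cst.
under [X in primitive _ _ X]funext do rewrite big_cons.
under [X in primitive _ _ _ X]funext do rewrite big_cons.
exact: primitiveD.
Qed.

Lemma primitiveX p q g h n : primitive p q g h ->
  primitive p q (fun x => g x ^+ n.+1) (fun x => n.+1%:R * g x ^+ n * h x).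
Proof.
move=> gh; elim: n => [|n IH].
  by under [X in primitive _ _ _ X]funext do rewrite expr0 !mul1r.
under [X in primitive _ _ X]funext do rewrite exprS.
have := primitiveM gh IH; congr primitive.
by apply/funext => x; rewrite -[in RHS]natr1 !exprS; ring.
Qed.

Lemma primitive_eq_in p q g1 g2 h1 h2 :
  (forall x, x \in `[p, q] -> g1 x = g2 x) ->
  {ae mu, forall x, x \in `]p, q[ -> h1 x = h2 x} ->
  primitive p q g1 h1 -> primitive p q g2 h2.
Proof.
move=> g12 h12 [[k kP] d1]; split.
  by exists k => x y xp yp; rewrite -!g12// kP.
move: h12 d1; apply: aeS2 => x E D xpq; rewrite -E//.
apply: der_near (D xpq).
have : \forall y \near x, y \in `]p, q[ by exact: near_in_itvoo.
by apply: filterS => y yp; apply: g12; exact: subset_itv_oo_cc.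
Qed.

Lemma primitive_sub p q p' q' g h : p <= p' -> q' <= q ->
  primitive p q g h -> primitive p' q' g h.
Proof.
move=> pp qq [[k kP] d]; split.
  by exists k => x y xp yp; apply: kP; [move: xp|move: yp];
    apply: subset_itv; rewrite bnd_simp.
move: d; apply: aeS => x D xpq; apply: D; move: xpq.
by apply: subset_itv; rewrite bnd_simp.
Qed.

Lemma ae_affine c d (P : R -> Prop) : c != 0 -> {ae mu, forall x, P x} ->
  {ae mu, forall x, P (c * x + d)}.
Proof.
move=> c0 H; have [cp|cn] := ltP 0 c.
  exact: (null_affine d cp H).
have cN : 0 < - c by rewrite oppr_gt0 lt_neqAle c0.
have := null_affine d cN H => /null_opp; apply: negligibleS => t /=.
by rewrite mulrNN.
Qed.

Lemma primitive_affine p q p' q' c d g h : c != 0 ->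
  (forall x, x \in `[p', q'] -> c * x + d \in `[p, q]) ->
  (forall x, x \in `]p', q'[ -> c * x + d \in `]p, q[) ->
  primitive p q g h ->
  primitive p' q' (fun x => g (c * x + d)) (fun x => realC c * h (c * x + d)).
Proof.
move=> c0 sub subo [[k kP] D]; split.
  exists (k * `|c|) => x y xp yp.
  apply: le_trans (kP _ _ (sub _ xp) (sub _ yp)) _.
  by rewrite opprD addrACA subrr addr0 -mulrBr normrM mulrA.
have := ae_affine d c0 D; apply: aeS => x Dx xp.
by apply: der_affine; apply: Dx; exact: subo.
Qed.

Lemma primitive_glue p m q g h : p <= m -> m <= q ->
  primitive p m g h -> primitive m q g h -> primitive p q g h.
Proof.
move=> pm mq [l1 d1] [l2 d2].
have [k1 k10 {}l1] := lipC_ge0 l1; have [k2 k20 {}l2] := lipC_ge0 l2.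
split; last first.
  move: (ae_neq m) d1 d2; apply: aeS3 => x xm D1 D2; rewrite in_itv /= => /andP[px xq].
  move: xm; rewrite neq_lt => /orP[xm|mx].
    by apply: D1; rewrite in_itv /= px.
  by apply: D2; rewrite in_itv /= mx.
exists (k1 + k2).
suff H x y : x \in `[p, q] -> y \in `[p, q] -> x <= y ->
    modC (g x - g y) <= (k1 + k2) * `|x - y|.
  move=> x y xp yp; have [xy|yx] := leP x y; first exact: H.
  by rewrite modC_dist distrC; apply: H => //; exact: ltW.
rewrite !in_itv /= => /andP[px xq] /andP[py yq] xy.
have n0 : 0 <= `|x - y| by [].
have [ym|my] := leP y m.
  apply: le_trans (l1 x y _ _) _; rewrite ?in_itv /= ?px ?py ?ym ?(le_trans xy)//.
  by rewrite ler_wpM2r// lerDl.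
have [xm|mx] := leP x m; last first.
  apply: le_trans (l2 x y _ _) _; rewrite ?in_itv /= ?xq ?yq ?(ltW my) ?(ltW mx)//.
  by rewrite ler_wpM2r// lerDr.
rewrite -[g x - g y](subrKA (g m)); apply: le_trans (modCD _ _) _.
rewrite mulrDl lerD//.
  apply: le_trans (l1 _ _ _ _) _; rewrite ?in_itv /= ?px ?pm ?xm ?lexx//.
  by rewrite ler_wpM2l// !ler0_norm ?subr_le0//; lra.
apply: le_trans (l2 _ _ _ _) _; rewrite ?in_itv /= ?mq ?lexx ?yq ?(ltW my)//.
by rewrite ler_wpM2l// !ler0_norm ?subr_le0 ?(ltW my)//; lra.
Qed.

(** Reduces an estimate of a complex increment to an estimate of the real part of
    a rotated function. *)
Lemma modC_phase (z : CC R) : exists2 w, modC w = 1 & w * z = realC (modC z).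
Proof.
have [z0|z0] := eqVneq (modC z) 0.
  by exists 1; rewrite ?modC1// mul1r z0; exact: modC_eq0.
pose zc : CC R := Complex (reC z) (- imC z).
have zcz : zc * z = realC (modC z ^+ 2).
  apply: reim_eq; first by rewrite reCM /= modC_sqr; ring.
  by rewrite imCM /=; ring.
exists (realC (modC z)^-1 * zc).
  rewrite modCM modC_realC ger0_norm ?invr_ge0 ?modC_ge0//.
  suff -> : modC zc = modC z by rewrite mulVf.
  by rewrite /zc /modC; case: (z) => a b /=; rewrite sqrrN.
by rewrite -mulrA zcz -realCM expr2 mulrA mulVf// mul1r.
Qed.

(** Mean value inequality: for w the phase of g q - g p, the real function
    Re (w g) - H has a nonpositive derivative. *)
Lemma primitive_growth p q g h (H H' : R -> R) : p <= q ->
  primitive p q g h ->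
  primitive p q (fun x => realC (H x)) (fun x => realC (H' x)) ->
  {ae mu, forall x, x \in `]p, q[ -> modC (h x) <= H' x} ->
  modC (g q - g p) <= H q - H p.
Proof.
move=> pq Pg PH hH.
have [w w1 wz] := modC_phase (g q - g p).
have [[k kP] D] := primitiveD (primitiveZ w Pg) (primitiveN PH).
suff : reC (w * g q - realC (H q)) <= reC (w * g p - realC (H p)).
  have : reC (w * (g q - g p)) = modC (g q - g p) by rewrite wz.
  rewrite mulrBr !reCD !reCN /=; lra.
apply: (@lip_nonincreasing R p q (fun x => reC (w * g x - realC (H x))) k pq).
- move=> x y xp yp; apply: le_trans (kP _ _ xp yp).
  by rewrite -reCN -reCD; exact: re_le_mod.
- move: D hH; apply: aeS2 => x D hH xpq; have [D1 _] := D xpq.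
  exists (reC (w * h x - realC (H' x))); first exact: D1.
  rewrite reCD reCN subr_le0 /=; apply: le_trans (hH xpq).
  apply: le_trans (ler_norm _) _; apply: le_trans (re_le_mod _) _.
  by rewrite modCM w1 mul1r.
Qed.

Lemma primitive_id p q c : primitive p q (fun x => realC (c * x)) (fun=> realC c).
Proof.
split; first by exists `|c| => x y _ _; rewrite -realCN -realCD modC_realC -mulrBr normrM.
apply: aeW => x _; split; last exact: is_derive_cst.
refine (is_derive_eq (is_deriveZ c (is_derive_id x 1)) _).
by rewrite -[_ *: _]/(c * 1) mulr1.
Qed.

Lemma primitive_bound p q g h M : p <= q -> primitive p q g h ->
  {ae mu, forall x, x \in `]p, q[ -> modC (h x) <= M} ->
  modC (g q - g p) <= M * (q - p).
Proof.
move=> pq gh hM; rewrite mulrBr.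
exact: (primitive_growth pq gh (primitive_id p q M)).
Qed.

(** The difference has derivative 0 a.e., and a Lipschitz function with this
    property is constant. *)
Lemma primitive_unique p q g1 g2 h1 h2 x0 : x0 \in `[p, q] ->
  primitive p q g1 h1 -> primitive p q g2 h2 ->
  {ae mu, forall x, x \in `]p, q[ -> h1 x = h2 x} ->
  g1 x0 = g2 x0 -> forall x, x \in `[p, q] -> g1 x = g2 x.
Proof.
move=> x0pq P1 P2 h12 g0 x xpq.
have := primitiveD P1 (primitiveN P2) => P.
suff H s t : s \in `[p, q] -> t \in `[p, q] -> s <= t ->
    modC ((g1 t - g2 t) - (g1 s - g2 s)) <= 0.
  have {}H s t : s \in `[p, q] -> t \in `[p, q] -> g1 t - g2 t = g1 s - g2 s.
    move=> sp tp; apply/eqP; rewrite -subr_eq0; apply/eqP/modC_eq0/eqP.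
    rewrite eq_le modC_ge0 andbT.
    by have [st|/ltW ts] := leP s t; [|rewrite modC_dist]; exact: H.
  by apply/eqP; rewrite -subr_eq0 (H _ _ x0pq xpq) g0 subrr.
rewrite !in_itv /= => /andP[ps sq] /andP[pt tq] st.
have := primitive_bound (M := 0) st (primitive_sub ps tq P).
rewrite mul0r; apply.
move: h12; apply: aeS => y E yst; rewrite E ?subrr ?modC0//.
by move: yst; apply: subset_itv; rewrite bnd_simp.
Qed.

End Primitive.

(** * Indefinite integrals *)

Section RealIntegral.
Variable R : realType.
Local Notation mu := (@lebesgue_measure R).
Variables (p q M : R) (f : R -> R).
Hypothesis mf : measurable_fun `[p, q] f.
Hypothesis fM : {ae mu, forall x, x \in `]p, q[ -> `|f x| <= M}.

(* f is only a.e. bounded; ft is a bounded function defined on the whole line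
   that has the same integrals inside [p, q]. *)
Let E : set R := `]p, q[ `&` [set x | `|f x| <= M].
Let ft := f \_ E.

Let mE : measurable E.
Proof.
have mf' : measurable_fun `]p, q[ (fun x => `|f x|).
  apply: measurableT_comp => //; apply: measurable_funS mf => //.
  exact: subset_itv_oo_cc.
rewrite [E](_ : _ = `]p, q[ `&` (fun x => `|f x|) @^-1` `]-oo, M]).
  exact: mf'.
by rewrite predeqE => x; rewrite /E /= in_itv.
Qed.

Let mft : measurable_fun setT ft.
Proof.
apply/(measurable_restrictT _ mE); apply: measurable_funS mf => //.
by move=> x [xpq _]; exact: subset_itv_oo_cc xpq.
Qed.

Let ftM x : `|ft x| <= `|M|.
Proof.
rewrite /ft patchE; case: ifPn => [|_]; last by rewrite normr0.
by rewrite inE => -[_ /= fx]; apply: le_trans fx (ler_norm _).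
Qed.

Let fft : {ae mu, forall x, x \in `[p, q] -> f x = ft x}.
Proof.
apply: (aeS3 _ fM (ae_neq p) (ae_neq q)) => x H xp xq.
rewrite in_itv /= => /andP[px qx].
have xpq : x \in `]p, q[.
  by rewrite in_itv /= !lt_neqAle px qx [p == x]eq_sym xp xq.
by rewrite /ft patchE mem_set//; split => //; exact: H.
Qed.

Let ift x y : mu.-integrable `[x, y] (EFin \o ft).
Proof.
apply: measurable_bounded_integrable => //.
- exact/compact_finite_measure/segment_compact.
- by apply: measurable_funS mft.
- exists `|M|; split; first exact: num_real.
  by move=> z Mz t _ /=; apply: le_trans (ftM t) (ltW Mz).
Qed.

Let int_ft x y : p <= x -> y <= q ->
  \int[mu]_(t in `[x, y]) f t = \int[mu]_(t in `[x, y]) ft t.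
Proof.
move=> px yq; rewrite /Rintegral; congr fine; apply: ae_eq_integral => //.
- apply/measurable_EFinP; apply: measurable_funS mf => //.
  by apply: subset_itv; rewrite bnd_simp.
- by apply/measurable_EFinP; exact: measurable_funS mft.
- apply: (aeS _ fft) => t /= H txy; rewrite H//.
  by move: txy; apply: subset_itv; rewrite bnd_simp.
Qed.

Lemma Rintegral_split x : x \in `[p, q] ->
  \int[mu]_(t in `[x, q]) f t =
  \int[mu]_(t in `[p, q]) f t - \int[mu]_(t in `[p, x]) f t.
Proof.
rewrite in_itv /= => /andP[px xq].
rewrite !int_ft// Rintegral_itvB ?bnd_simp//.
rewrite Rintegral_itv_obnd_cbnd//.
by apply: integrableS (ift x q) => //; exact: subset_itv_oc_cc.
Qed.

Lemma Rintegral_lip x y : x \in `[p, q] -> y \in `[p, q] ->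
  `|\int[mu]_(t in `[p, x]) f t - \int[mu]_(t in `[p, y]) f t|
    <= `|M| * `|x - y|.
Proof.
suff H u v : u \in `[p, q] -> v \in `[p, q] -> u <= v ->
  `|\int[mu]_(t in `[p, v]) f t - \int[mu]_(t in `[p, u]) f t|
    <= `|M| * `|v - u|.
  move=> xp yp; have [yx|/ltW xy] := leP y x; first exact: H.
  by rewrite distrC [X in _ * X]distrC; exact: H.
rewrite !in_itv /= => /andP[pu uq] /andP[pv vq] uv.
rewrite !int_ft// Rintegral_itvB ?bnd_simp//.
have iuv : mu.-integrable `]u, v] (EFin \o ft).
  by apply: integrableS (ift u v) => //; exact: subset_itv_oc_cc.
apply: le_trans (le_normr_Rintegral _ iuv) _ => //.
have := @le_Rintegral _ _ R mu `]u, v]%classic (fun t => `|ft t|) (cst `|M|).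
move=> /(_ _ _ _ _)/le_trans; apply => //.
- exact: integrable_norm iuv.
- apply: measurable_bounded_integrable => //.
    apply: le_lt_trans (compact_finite_measure (@segment_compact _ u v)).
    by apply: le_measure; rewrite ?inE//; exact: subset_itv_oc_cc.
  exists `|M|; split; first exact: num_real.
  by move=> z Mz t _ /=; rewrite normr_id ltW.
- have E1 : (mu `]u, v]%classic = (v - u)%:E)%E.
    rewrite lebesgue_measure_itv /= lte_fin; case: ltP => // vu.
    by rewrite (@le_anti _ _ u v) ?subrr// uv.
  by rewrite Rintegral_cst// [X in fine X]E1 /= (ger0_norm (x := v - u)) ?subr_ge0.
Qed.

Lemma Rintegral_derive : {ae mu, forall x, x \in `]p, q[ ->
  is_derive x 1 (fun x => \int[mu]_(t in `[p, x]) f t) (f x)}.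
Proof.
have loc : locally_integrable setT ft.
  split => //; first exact: openT.
  move=> K _ cK.
  have iK : mu.-integrable K (EFin \o ft).
    apply: measurable_bounded_integrable => //.
    - exact: compact_measurable.
    - exact: compact_finite_measure.
    - by apply: measurable_funS mft.
    - exists `|M|; split; first exact: num_real.
      by move=> z Mz t _ /=; apply: le_trans (ftM t) (ltW Mz).
  by case/integrableP: iK.
apply: (aeS2 _ fft (@FTC1 R ft (BLeft p) (fun y => ift p y) loc)) => x E1 D1 xpq.
have xcc : x \in `[p, q] by exact: subset_itv_oo_cc xpq.
rewrite E1//; have [|d e] := D1.
  by move: xpq; rewrite in_itv /= => /andP[px _]; rewrite lte_fin.
apply: near_eq_is_derive; last first.
  by apply: DeriveDef; [exact: d|rewrite -derive1E; exact: e].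
have : \forall y \near x, y \in `]p, q[ by exact: near_in_itvoo.
apply: filterS => y; rewrite in_itv /= => /andP[py yq].
by rewrite int_ft// ltW.
Qed.

End RealIntegral.

Section ComplexIntegral.
Variable R : realType.
Local Notation mu := (@lebesgue_measure R).
Implicit Types (p q x y : R) (f g : R -> CC R).

(** A bound that holds a.e. makes the indefinite integrals Lipschitz. *)
Definition bounded_measurable p q f : Prop :=
  [/\ measurable_fun `[p, q] (fun t => reC (f t)),
      measurable_fun `[p, q] (fun t => imC (f t)) &
      exists M, {ae mu, forall x, x \in `]p, q[ -> modC (f x) <= M}].

Lemma intC_set1 f x : intC `[x, x] f = 0.
Proof. by rewrite /intC set_itv1 !Rintegral_set1. Qed.

Lemma primitive_intC p q f : bounded_measurable p q f ->
  primitive p q (fun x => intC `[p, x] f) f.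
Proof.
move=> [mr mi [M fM]].
have rM : {ae mu, forall x, x \in `]p, q[ -> `|reC (f x)| <= M}.
  by apply: (aeS _ fM) => x H /H; apply: le_trans; exact: re_le_mod.
have iM : {ae mu, forall x, x \in `]p, q[ -> `|imC (f x)| <= M}.
  by apply: (aeS _ fM) => x H /H; apply: le_trans; exact: im_le_mod.
split; last first.
  by apply: (aeS2 _ (Rintegral_derive mr rM) (Rintegral_derive mi iM))
    => x H1 H2 xpq; split; [exact: H1|exact: H2].
exists (`|M| + `|M|) => x y xp yp; apply: le_trans (mod_le_reim _) _.
rewrite reCD imCD reCN imCN mulrDl lerD//.
  exact: (Rintegral_lip mr rM).
exact: (Rintegral_lip mi iM).
Qed.

Lemma primitive_intC_right p q f : bounded_measurable p q f ->
  primitive p q (fun x => intC `[x, q] f) (fun x => - f x).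
Proof.
move=> bf; have [mr mi [M fM]] := bf.
have rM : {ae mu, forall x, x \in `]p, q[ -> `|reC (f x)| <= M}.
  by apply: (aeS _ fM) => x H /H; apply: le_trans; exact: re_le_mod.
have iM : {ae mu, forall x, x \in `]p, q[ -> `|imC (f x)| <= M}.
  by apply: (aeS _ fM) => x H /H; apply: le_trans; exact: im_le_mod.
have := primitiveD (primitive_cst p q (intC `[p, q] f)) (primitiveN (primitive_intC bf)).
apply: primitive_eq_in => [x xpq|].
  apply: reim_eq; rewrite ?reCD ?imCD ?reCN ?imCN.
    by rewrite [RHS](Rintegral_split mr rM xpq).
  by rewrite [RHS](Rintegral_split mi iM xpq).
by apply: aeW => x _; rewrite add0r.
Qed.

(** Makes iterated integrals admissible integrands again. *)
Lemma lipC_measurable p q g : lipC p q g ->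
  measurable_fun `[p, q] (fun t => reC (g t)) /\
  measurable_fun `[p, q] (fun t => imC (g t)).
Proof.
move=> [k kP].
suff H (f : R -> R) : (forall x y, x \in `[p, q] -> y \in `[p, q] ->
    `|f x - f y| <= k * `|x - y|) -> measurable_fun `[p, q] f.
  split; apply: H => x y xp yp; apply: le_trans (kP _ _ xp yp).
    by rewrite -reCN -reCD; exact: re_le_mod.
  by rewrite -imCN -imCD; exact: im_le_mod.
move=> fk; apply: (@measurable_fun_itv_cc _ _ _ false true).
apply: open_continuous_measurable_fun => // x.
rewrite inE /= => xpq; apply/cvgrPdist_lt => e e0.
have K0 : 0 < `|k| + 1 by rewrite ltr_wpDl.
have d0 : 0 < e / (`|k| + 1) by rewrite divr_gt0.
near=> y; have ypq : y \in `]p, q[ by near: y; exact: near_in_itvoo.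
apply: le_lt_trans (fk _ _ _ _) _; try exact: subset_itv_oo_cc.
have : `|x - y| < e / (`|k| + 1).
  by near: y; exact: (@cvgr_dist_lt _ _ _ _ _ id).
rewrite ltr_pdivlMr// => xy; apply: le_lt_trans xy.
rewrite mulrC ler_wpM2l//; apply: le_trans (ler_norm _) _; by rewrite lerDl.
Unshelve. all: by end_near. Qed.

End ComplexIntegral.

(** * Iterated integrals and the formula of Chen *)

Section IteratedIntegrals.
Variable R : realType.
Local Notation mu := (@lebesgue_measure R).
Local Notation tpi := (twopi R).
Implicit Types (a b : X R) (w : seq nat).

Lemma pi_lt_twopi : pi < tpi.
Proof. by rewrite /twopi mulr_natl mulr2n ltrDl pi_gt0. Qed.

Lemma X_bound a : exists2 l : R, 0 < l &
  forall n, {ae mu, forall x, modC (a n x) <= l ^+ n.+1}.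
Proof.
have [_ [l l0 la]] := XP a; exists l => // n.
by have /ess_supP := la n; apply: aeS => x; rewrite lee_fin.
Qed.

Lemma bounded_measurable_mul a n p q (g : R -> CC R) : lipC p q g ->
  bounded_measurable p q (fun t => a n t * g t).
Proof.
move=> lg; have [rg ig] := lipC_measurable lg.
have [ha _] := XP a; have [_ ra ia] := ha n.
have [l _ la] := X_bound a; have [M M0 gM] := lipC_bounded lg.
have mra : measurable_fun `[p, q] (fun t => reC (a n t)) by exact: measurable_funS ra.
have mia : measurable_fun `[p, q] (fun t => imC (a n t)) by exact: measurable_funS ia.
split.
- under [X in measurable_fun _ X]funext do rewrite reCM.
  by apply: measurable_funB; apply: measurable_funM.
- under [X in measurable_fun _ X]funext do rewrite imCM.
  by apply: measurable_funD; apply: measurable_funM.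
- exists (l ^+ n.+1 * M); apply: (aeS _ (la n)) => x H xpq.
  rewrite modCM ler_pM ?modC_ge0// gM//.
  exact: subset_itv_oo_cc xpq.
Qed.

Lemma iter_int_twopi a i w : iter_int a (i :: w) tpi = 0.
Proof. exact: intC_set1. Qed.

(** The lower end of the outermost integral is the variable, so that
    differentiation removes the first letter of the word. *)
Lemma iter_int_primitive a i w :
  primitive 0 tpi (iter_int a (i :: w)) (fun t => - (a i t * iter_int a w t)).
Proof.
elim: w i => [|j w IH] i; apply: primitive_intC_right;
  apply: bounded_measurable_mul.
  exact: (primitive_cst _ _ _).1.
exact: (IH j).1.
Qed.

Lemma circ_id (t : R) : 0 < t -> t <= tpi -> circ t = t.
Proof.
move=> t0 t1; rewrite /circ (_ : Num.ceil _ = 1) ?subrr ?mulr0 ?subr0//.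
apply/eqP; rewrite ceil_eq; apply/andP; split.
  by rewrite divr_gt0// twopi_gt0.
by rewrite ler_pdivrMr ?twopi_gt0// mul1r.
Qed.

Lemma concat_left a b n (t : R) : 0 < t -> t <= pi ->
  concat_fun a b n t = 2 * a n (2 * t).
Proof.
move=> t0 t1; rewrite /concat_fun circ_id ?t1//.
exact: le_trans t1 (ltW pi_lt_twopi).
Qed.

Lemma concat_right a b n (t : R) : pi < t -> t <= tpi ->
  concat_fun a b n t = 2 * b n (2 * t - tpi).
Proof.
move=> t0 t1; rewrite /concat_fun circ_id//.
  by rewrite leNgt t0.
exact: lt_trans (pi_gt0 _) t0.
Qed.

Lemma realC2 : realC 2 = 2 :> CC R. Proof. exact: (realC_nat R 2). Qed.

(** On the second half the path is b run at double speed, and the factor 2 in the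
    definition of a * b is the derivative of the change of time. *)
Lemma iter_int_concat_right a b w s : s \in `[pi, tpi] ->
  iter_int (concat_fun a b) w s = iter_int b w (2 * s - tpi).
Proof.
have p0 := pi_gt0 R; have ptpi := pi_lt_twopi.
elim: w s => // i w IH.
apply: (@primitive_unique _ _ _ _ _ _ _ tpi).
- by rewrite bound_itvE ltW.
- apply: primitive_sub (iter_int_primitive (concatX a b) i w) => //; exact: ltW.
- apply: primitive_affine (iter_int_primitive _ _ _) => // x;
    rewrite !in_itv /= /twopi; move: p0; lra.
- apply: aeW => x xpq; rewrite IH; last exact: subset_itv_oo_cc xpq.
  move: xpq; rewrite in_itv /= => /andP[x1 x2].
  by rewrite concat_right ?(ltW x2)// realC2; ring.
- rewrite [LHS](iter_int_twopi (concatX a b)).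
  rewrite (_ : 2 * tpi - tpi = tpi) ?iter_int_twopi//; ring.
Qed.

(** Differentiating with respect to s removes the first letter on both sides, so
    the formula follows by induction on the word; at s = pi only the term j = 0
    survives, because the other integrals of a are over a point. *)
Lemma iter_int_concat_left a b w s : s \in `[0, pi] ->
  iter_int (concat_fun a b) w s =
    \sum_(j < (size w).+1)
      iter_int a (take j w) (2 * s) * iter_int b (drop j w) 0.
Proof.
have p0 := pi_gt0 R; have ptpi := pi_lt_twopi.
elim: w s => [|i w IH] s s0; first by rewrite big_ord1 /= mulr1.
rewrite big_ord_recl /= mul1r; move: s s0.
apply: (@primitive_unique _ _ _ _ _ _ _ pi).
- by rewrite bound_itvE ltW.
- apply: primitive_sub (iter_int_primitive (concatX a b) i w) => //; exact: ltW.
- apply: primitiveD; first exact: primitive_cst.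
  apply: primitive_sum => j; under [X in primitive _ _ X]funext do rewrite mulrC.
  apply: primitiveZ; rewrite -[2]/(2 : R).
  under [X in primitive _ _ X]funext => t do rewrite -[2 * t]addr0.
  apply: (@primitive_affine _ 0 tpi _ _ 2 0 (iter_int a (i :: take j w)))
    (iter_int_primitive a i (take j w)) => // x;
    rewrite !in_itv /= /twopi; move: p0; lra.
- apply: aeW => x xpq; rewrite add0r IH; last exact: subset_itv_oo_cc xpq.
  move: xpq; rewrite in_itv /= => /andP[x1 x2].
  rewrite concat_left ?(ltW x2)// big_distrr -sumrN /=; apply: eq_bigr => j _.
  by rewrite addr0 realC2; ring.
- rewrite -[LHS]/(iter_int (concat_fun a b) (i :: w) pi).
  rewrite iter_int_concat_right; last by rewrite bound_itvE ltW.
  rewrite big1 ?addr0 => [|j _]; last first.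
    by rewrite -[X in X * _]/(iter_int a (i :: take j w) tpi) iter_int_twopi mul0r.
  by congr (iter_int b); rewrite /twopi subrr.
Qed.

(** The deconcatenation product, dual to the concatenation of words. *)
Definition chen (f g : seq nat -> CC R) w : CC R :=
  \sum_(j < (size w).+1) f (take j w) * g (drop j w).

Definition chen_unit w : CC R := (w == [::])%:R.

Local Notation I a := (fun w => basic_int w a).

Theorem basic_int_concat a b : I (concatX a b) = chen (I a) (I b).
Proof.
apply/funext => w; rewrite /basic_int iter_int_concat_left ?mulr0//.
by rewrite bound_itvE ltW// pi_gt0.
Qed.

Lemma concat_inv_antisym a n t : 0 < t -> t < pi ->
  concat_fun a (inv_fun a) n (tpi - t) = - concat_fun a (inv_fun a) n t.
Proof.
move=> t0 t1; have tt : t < tpi by exact: lt_trans t1 pi_lt_twopi.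
rewrite -[inv_fun a]/(Xfun (invX a)) (concat_left _ _ _ t0 (ltW t1)).
rewrite concat_right; last by rewrite gerBl ltW.
  by rewrite /= /inv_fun mulrN; congr (- (2 * a n _)); ring.
by rewrite /twopi; lra.
Qed.

(** The path a * a^-1 is antisymmetric about pi, so its iterated integrals from s
    and from 2 pi - s satisfy the same recursion and agree at s = pi.  At s = 0
    this compares the integrals over the whole circle with those over a point. *)
Lemma basic_int_concat_inv a : I (concatX a (invX a)) = chen_unit.
Proof.
apply/funext => -[|i w]; first by [].
have p0 := pi_gt0 R; have ptpi := pi_lt_twopi.
set e := concatX a (invX a).
suff H v s : s \in `[0, pi] -> iter_int e v s = iter_int e v (tpi - s).
  rewrite /basic_int H ?subr0 ?[LHS](iter_int_twopi e)// bound_itvE ltW//.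
elim: v s => // {w}j w IH.
apply: (@primitive_unique _ _ _ _ _ _ _ pi).
- by rewrite bound_itvE ltW.
- apply: primitive_sub (iter_int_primitive e j w) => //; exact: ltW.
- under [X in primitive _ _ X]funext => t do rewrite addrC -mulN1r.
  apply: (@primitive_affine _ 0 tpi _ _ (-1) tpi (iter_int e (j :: w)))
    (iter_int_primitive e j w) => [|x|x]; first by rewrite oppr_eq0 oner_eq0.
    by rewrite !in_itv /= /twopi; move: p0; lra.
  by rewrite !in_itv /= /twopi; move: p0; lra.
- apply: aeW => x xpq; rewrite IH; last exact: subset_itv_oo_cc xpq.
  move: xpq; rewrite in_itv /= => /andP[x1 x2].
  rewrite mulN1r [- x + _]addrC concat_inv_antisym// realCN realC1; ring.
- by congr (iter_int e); rewrite /twopi; ring.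
Qed.

Lemma invXK a : Xfun (invX (invX a)) = Xfun a.
Proof.
apply/funext => n; apply/funext => t /=; rewrite /inv_fun opprK.
by congr (a n _); ring.
Qed.

Lemma basic_int_inv_concat a : I (concatX (invX a) a) = chen_unit.
Proof.
rewrite -(basic_int_concat_inv (invX a)).
apply/funext => w; rewrite /basic_int.
by rewrite -[Xfun (concatX _ (invX _))]/(concat_fun (invX a) (invX (invX a))) invXK.
Qed.

Lemma basic_int_zero : I (zeroX R) = chen_unit.
Proof.
apply/funext => -[|i w] //; rewrite /basic_int /= /intC.
apply: reim_eq => /=; under eq_Rintegral do rewrite mul0r.
  by rewrite Rintegral_cst// mul0r.
by rewrite Rintegral_cst// mul0r.
Qed.

Lemma chen_nil f g : chen f g [::] = f [::] * g [::].
Proof. by rewrite /chen big_ord1. Qed.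

Lemma chen_cons f g i w :
  chen f g (i :: w) = f [::] * g (i :: w) + chen (f \o cons i) g w.
Proof. by rewrite /chen big_ord_recl. Qed.

Lemma chenA : associative chen.
Proof.
move=> f g h; apply/funext => w; elim: w f => [|i w IH] f.
  by rewrite !chen_nil mulrA.
rewrite !chen_cons chen_nil IH mulrDr !mulrA -addrA; congr (_ + _).
rewrite {2 4}/chen big_distrr -big_split; apply: eq_bigr => j _ /=.
by rewrite chen_cons /=; ring.
Qed.

Lemma chen1f f : chen chen_unit f = f.
Proof.
apply/funext => -[|i w]; first by rewrite chen_nil mul1r.
rewrite chen_cons mul1r /chen big1 ?addr0// => j _.
by rewrite /chen_unit /= mul0r.
Qed.

Lemma chenf1 f : chen f chen_unit = f.
Proof.
apply/funext => w; elim: w f => [|i w IH] f; first by rewrite chen_nil mulr1.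
by rewrite chen_cons IH mulr0 add0r.
Qed.

Lemma UX_basic_int a : UX a <-> I a = chen_unit.
Proof.
split=> [Ua|Ia w w0]; last by rewrite -[LHS]/(I a w) Ia /chen_unit (negPf w0).
apply/funext => w; rewrite /chen_unit; case: eqVneq => [->//|]; exact: Ua.
Qed.

(** By Chen's formula the integrals of the inverse path are a two-sided inverse
    of the integrals of the path. *)
Lemma simX_basic_int a b : simX a b <-> I a = I b.
Proof.
rewrite /simX UX_basic_int basic_int_concat.
have := basic_int_concat_inv b; rewrite basic_int_concat => bV.
have := basic_int_inv_concat b; rewrite basic_int_concat => Vb.
split=> [abV|->]; last exact: bV.
by rewrite -[LHS]chenf1 -Vb chenA abV chen1f.
Qed.

Lemma toG_basic_int a b : toG a = toG b <-> I a = I b.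
Proof.
split=> [[] E|E]; last first.
  apply: val_inj => /=; apply/seteqP; split=> c;
    by rewrite /simclass /= !simX_basic_int E.
have : simclass b b by rewrite /simclass /= simX_basic_int.
by rewrite -E /simclass /= simX_basic_int.
Qed.

Lemma toG_rep (A : GX R) : toG (class_rep A) = A.
Proof.
by apply: val_inj; rewrite /class_rep /=; case: cid2.
Qed.

Lemma basic_int_rep a : I (class_rep (toG a)) = I a.
Proof. by apply/toG_basic_int; exact: toG_rep. Qed.

End IteratedIntegrals.

(** * Geometrically dominated series of complex numbers *)

Section Series.
Variable R : realType.
Implicit Types (u : nat -> CC R) (z s : CC R) (C q : R).

Lemma cvgCP u s : u @ \oo --> s <->
  forall e : R, 0 < e -> \forall n \near \oo, modC (s - u n) < e.
Proof.
split=> [/cvgrPdist_lt H e e0|H].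
  have := H (realC e); rewrite -[0]/(realC 0) realC_lt => /(_ e0).
  by apply: filterS => n; rewrite normCE realC_lt.
apply/cvgrPdist_lt => e; rewrite ltcE => /andP[/= im0 re0].
have -> : e = realC (reC e) by apply: reim_eq => //=; exact/eqP.
by have := H _ re0; apply: filterS => n; rewrite normCE realC_lt.
Qed.

Lemma cvgC_reim u s : u @ \oo --> s <->
  (fun n => reC (u n)) @ \oo --> reC s /\ (fun n => imC (u n)) @ \oo --> imC s.
Proof.
rewrite cvgCP; split=> [H|[/cvgrPdist_lt Hr /cvgrPdist_lt Hi] e e0].
  split; apply/cvgrPdist_lt => e /H; apply: filterS => n; apply: le_lt_trans.
    by rewrite -reCN -reCD; exact: re_le_mod.
  by rewrite -imCN -imCD; exact: im_le_mod.
have e2 : 0 < e / 2 by rewrite divr_gt0.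
apply: filterS2 (Hr _ e2) (Hi _ e2) => n r i.
apply: le_lt_trans (mod_le_reim _) _; rewrite reCD imCD reCN imCN.
by rewrite [e]splitr ltrD.
Qed.

Lemma cvgC_squeeze u s (b : nat -> R) :
  (forall n, modC (s - u n) <= b n) -> b @ \oo --> (0 : R) -> u @ \oo --> s.
Proof.
move=> ub /cvgrPdist_lt b0; apply/cvgCP => e /b0; apply: filterS => n.
by rewrite sub0r normrN => /(le_lt_trans (ler_norm _)); exact: le_lt_trans.
Qed.

Lemma cvgC_unique u s1 s2 : u @ \oo --> s1 -> u @ \oo --> s2 -> s1 = s2.
Proof.
move=> /cvgC_reim[r1 i1] /cvgC_reim[r2 i2].
by apply: reim_eq; [exact: cvg_unique r1 r2|exact: cvg_unique i1 i2].
Qed.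

Lemma cvgC_le u s M : (forall n, modC (u n) <= M) -> u @ \oo --> s -> modC s <= M.
Proof.
move=> uM /cvgCP us; apply/ler_addgt0Pr => e /us [N _ /(_ N (leqnn _)) H].
rewrite -[s](subrK (u N)); apply: le_trans (modCD _ _) _.
by rewrite addrC lerD// ltW.
Qed.

Lemma geo_half_sum n : \sum_(i < n) 2^-1 ^+ i.+1 = 1 - 2^-1 ^+ n :> R.
Proof.
elim: n => [|n IH]; first by rewrite big_ord0 expr0 subrr.
by rewrite big_ord_recr /= IH exprS; field.
Qed.

Lemma geo_sum_le q m n : 0 <= q <= 2^-1 -> \sum_(m <= i < n) q ^+ i <= 2 * q ^+ m.
Proof.
move=> /andP[q0 q2]; have [nm|/ltnW mn] := leqP n m.
  by rewrite big_geq// mulr_ge0// exprn_ge0.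
rewrite -{1}[m]add0n big_addn big_mkord.
under eq_bigr do rewrite exprD.
rewrite -big_distrl /= ler_wpM2r// ?exprn_ge0//.
apply: (@le_trans _ _ (\sum_(i < n - m) 2^-1 ^+ i)).
  by apply: ler_sum => i _; rewrite lerXn2r// nnegrE ?invr_ge0//; exact: le_trans q2.
have := geo_half_sum (n - m); under eq_bigr do rewrite exprS.
rewrite -big_distrr /= => H.
have : 0 <= 2^-1 ^+ (n - m) :> R by rewrite exprn_ge0// invr_ge0.
move: H; set S := \sum_(i < _) _; lra.
Qed.

Section Geometric.
Variables (u : nat -> CC R) (C q : R).
Hypotheses (C0 : 0 <= C) (q01 : 0 <= q <= 2^-1).
Hypothesis uq : forall i, modC (u i) <= C * q ^+ i.

Lemma geo_partial m n : (m <= n)%N ->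
  modC (series u n - series u m) <= 2 * C * q ^+ m.
Proof.
move=> mn; rewrite sub_series_geq//.
apply: le_trans (modC_sum _ _ _) _.
apply: (@le_trans _ _ (\sum_(m <= k < n) C * q ^+ k)).
  by apply: ler_sum => k _; exact: uq.
rewrite -big_distrr /= [2 * C]mulrC -mulrA ler_wpM2l//.
exact: geo_sum_le.
Qed.

Lemma geo_tail s m : series u @ \oo --> s ->
  modC (s - series u m) <= 2 * C * q ^+ m.
Proof.
move=> /cvgCP us; apply/ler_addgt0Pr => e /us [N _ HN].
pose n := maxn N m.
rewrite -(subrKA (series u n)) addrC; apply: le_trans (modCD _ _) _.
rewrite lerD//; first by rewrite geo_partial// leq_maxr.
by apply/ltW/HN => /=; rewrite leq_maxl.
Qed.

Lemma geo_bound s : series u @ \oo --> s -> modC s <= 2 * C.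
Proof.
by move=> /(geo_tail 0); rewrite /series /= big_geq// subr0 expr0 mulr1.
Qed.

Lemma geo_cvg : exists s, series u @ \oo --> s.
Proof.
have [q0 q2] := andP q01.
have q1 : `|q| < 1 by rewrite ger0_norm//; lra.
have K (f : nat -> R) : (forall i, `|f i| <= modC (u i)) -> cvgn (series f).
  move=> fu; apply: normed_cvg.
  apply: (series_le_cvg (v_ := geometric C q)).
  - by move=> i /=.
  - by move=> i /=; rewrite mulr_ge0// exprn_ge0.
  - by move=> i; apply: le_trans (fu i) (uq i).
  - exact: is_cvg_geometric_series.
have /cvg_ex[/= x xP] := K (fun i => reC (u i)) (fun i => re_le_mod _).
have /cvg_ex[/= y yP] := K (fun i => imC (u i)) (fun i => im_le_mod _).
exists (Complex x y); apply/cvgC_reim; split.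
  rewrite [f in f @ _ --> _](_ : _ = series (fun i => reC (u i)))//.
  apply/funext => n; rewrite /series /=.
  by elim/big_rec2: _ => // i a b _ <-; rewrite reCD.
rewrite [f in f @ _ --> _](_ : _ = series (fun i => imC (u i)))//.
apply/funext => n; rewrite /series /=.
by elim/big_rec2: _ => // i a b _ <-; rewrite imCD.
Qed.

End Geometric.

Lemma half_pow_cvg0 C : (fun n => C * 2^-1 ^+ n) @ \oo --> (0 : R).
Proof.
rewrite -[0](mulr0 C); apply: cvgM; first exact: cvg_cst.
by apply: cvg_expr; rewrite ger0_norm; lra.
Qed.

End Series.

(** * Words of given weight *)

Section Words.

(** The letter i stands for the coefficient of v^(i+2) in the equation, which
    raises the degree by i + 1. *)
Definition weight (w : seq nat) : nat := sumn (map succn w).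

(** The transport equation differentiates the term r^(m+1) contributed by a word
    of weight m, which produces the factor m + 1. *)
Fixpoint word_coef (w : seq nat) : nat :=
  if w is _ :: w' then (weight w').+1 * word_coef w' else 1.

(** The words of weight n; k bounds the depth of the recursion, which is not
    structural in n. *)
Fixpoint words_rec (k n : nat) : seq (seq nat) :=
  if n is n'.+1 then
    if k is k'.+1 then
      flatten [seq [seq i :: w | w <- words_rec k' (n' - i)] | i <- iota 0 n]
    else [::]
  else [:: [::]].

Definition words n := words_rec n n.

Lemma words_recS k n : words_rec k.+1 n.+1 =
  flatten [seq [seq i :: w | w <- words_rec k (n - i)] | i <- iota 0 n.+1].
Proof. by []. Qed.

Lemma words_rec_enough k n : (n <= k)%N -> words_rec k n = words n.
Proof.
rewrite /words; elim: n {-2}n (leqnn n) k => [|m IH] [|n] // nm [|k] // nk.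
rewrite !words_recS; congr flatten; apply/eq_in_map => i; rewrite mem_iota /= add0n => _.
by rewrite !IH// ?leq_subr// (leq_trans (leq_subr _ _)).
Qed.

Lemma words0 : words 0 = [:: [::]]. Proof. by []. Qed.

Lemma wordsS n :
  words n.+1 = flatten [seq [seq i :: w | w <- words (n - i)] | i <- iota 0 n.+1].
Proof.
rewrite {1}/words words_recS; congr flatten; apply/eq_in_map => i _.
by rewrite words_rec_enough// leq_subr.
Qed.

Lemma weight_words n w : w \in words n -> weight w = n.
Proof.
elim: n {-2}n (leqnn n) w => [|m IH] [|n] nm w; rewrite ?words0 ?inE.
- by move/eqP->.
- by [].
- by move/eqP->.
rewrite wordsS => /allpairsPdep[i [v [+ vw ->]]]; rewrite mem_iota /= add0n => iN.
by rewrite -[LHS]/(i.+1 + weight v)%N (IH _ _ v vw) ?(leq_trans (leq_subr _ _))// addSn subnKC.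
Qed.

End Words.

(** * The coefficients of the flow *)

Section ReturnCoefficients.
Variable R : realType.
Local Notation mu := (@lebesgue_measure R).
Local Notation tpi := (twopi R).
Implicit Types (a b : X R) (w : seq nat).

(** The coefficient of r^(n+1) in Phi(s, r), the flow from time s to time 2 pi. *)
Definition flow_coef (a : nat -> R -> CC R) (n : nat) (s : R) : CC R :=
  \sum_(w <- words n) (word_coef w)%:R * iter_int a w s.

Lemma flow_coef0 a s : flow_coef a 0 s = 1.
Proof. by rewrite /flow_coef words0 big_seq1 /= mulr1. Qed.

Lemma flow_coef_cons (a : nat -> R -> CC R) n s : flow_coef a n.+1 s =
  \sum_(i < n.+1) \sum_(w <- words (n - i))
     ((n - i).+1 * word_coef w)%:R * iter_int a ((i : nat) :: w) s.
Proof.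
rewrite /flow_coef wordsS big_flatten big_map.
rewrite -[iota 0 n.+1]/(index_iota 0 n.+1) big_mkord; apply: eq_bigr => i _.
rewrite big_map big_seq [RHS]big_seq; apply: eq_bigr => w /weight_words ww.
by rewrite /= ww.
Qed.

Lemma flow_coef_twopi a n : flow_coef a n.+1 tpi = 0.
Proof.
rewrite flow_coef_cons big1// => i _; rewrite big1// => w _.
by rewrite (iter_int_twopi a) mulr0.
Qed.

(** The transport equation Phi_s + (sum_i a_i r^(i+1)) Phi_r = 0, coefficient by
    coefficient. *)
Lemma flow_coef_primitive a n : primitive 0 tpi (flow_coef a n.+1)
  (fun t => - \sum_(i < n.+1) (n - i).+1%:R * a i t * flow_coef a (n - i) t).
Proof.
rewrite (_ : flow_coef a n.+1 = fun s => \sum_(i < n.+1) \sum_(w <- words (n - i))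
     ((n - i).+1 * word_coef w)%:R * iter_int a ((i : nat) :: w) s); last first.
  by apply/funext => s; rewrite flow_coef_cons.
have := @primitive_sum R _ (index_enum 'I_n.+1) 0 tpi
  (fun i s => \sum_(w <- words (n - i))
     ((n - i).+1 * word_coef w)%:R * iter_int a ((i : nat) :: w) s)
  (fun i s => \sum_(w <- words (n - i))
     ((n - i).+1 * word_coef w)%:R * - (a i s * iter_int a w s)).
move=> /(_ (fun i => primitive_sum _ (fun w => primitiveZ _ (iter_int_primitive a i w)))).
congr primitive; apply/funext => s; rewrite -sumrN; apply: eq_bigr => i _.
rewrite /flow_coef big_distrr -sumrN; apply: eq_bigr => w _ /=.
by rewrite natrM; ring.
Qed.

(** The bound is a supersolution of the recursion.  The recursion contains the
    growing factor n - i + 1 <= n + 1, which is exactly what the derivative of an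
    (n+1)-st power provides; as 1 + 2 pi - s >= 1 and at least one power is lost at
    each step, an affine base suffices, and the rate 2 l turns the sum over i into
    sum_i 2^-(i+1) <= 1. *)
Lemma flow_coef_le a (l : R) : 0 < l ->
  (forall n, {ae mu, forall x, modC (a n x) <= l ^+ n.+1}) ->
  forall n s, s \in `[0, tpi] ->
    modC (flow_coef a n s) <= (2 * l * (1 + tpi - s)) ^+ n.
Proof.
move=> l0 la; elim/ltn_ind => -[_ s _|n IH s]; first by rewrite flow_coef0 modC1.
rewrite in_itv /= => /andP[s0 st].
pose U x := 2 * l * (1 + tpi - x).
have PU : primitive s tpi (fun x => realC (U x)) (fun=> realC (- (2 * l))).
  apply: primitive_eq_in (primitiveD (primitive_cst s tpi (realC (2 * l * (1 + tpi))))
    (primitive_id s tpi (- (2 * l)))).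
    by move=> x _; rewrite -realCD /U; congr realC; ring.
  by apply: aeW => x _; rewrite add0r.
have PH : primitive s tpi (fun x => realC (- U x ^+ n.+1))
    (fun x => realC (n.+1%:R * U x ^+ n * (2 * l))).
  apply: primitive_eq_in (primitiveN (primitiveX n PU)).
    by move=> x _; rewrite realCN realCX.
  apply: aeW => x _; rewrite -realCX -realC_nat -!realCM -realCN.
  by congr realC; ring.
have la' : {ae mu, forall x, forall n, modC (a n x) <= l ^+ n.+1}.
  exact/ae_foralln.
have := primitive_growth st (primitive_sub s0 (lexx _) (flow_coef_primitive a n)) PH.
rewrite flow_coef_twopi sub0r modCN => G; apply: (le_trans (G _)).
  apply: (aeS _ la') => x H; rewrite in_itv /= => /andP[sx xt].
  have u1 : 1 <= 1 + tpi - x by rewrite -addrA lerDl subr_ge0 ltW.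
  have u0 := le_trans ler01 u1.
  have U0 : 0 <= U x by rewrite /U !mulr_ge0// ltW.
  rewrite modCN; apply: le_trans (modC_sum _ _ _) _.
  apply: (@le_trans _ _ (\sum_(i < n.+1) n.+1%:R * U x ^+ n * (2 * l) * 2^-1 ^+ i.+1)).
    apply: ler_sum => i _; rewrite !modCM modC_nat.
    have iN : (i <= n)%N by rewrite -ltnS.
    have Hphi : modC (flow_coef a (n - i) x) <= U x ^+ (n - i).
      apply: IH; first by rewrite ltnS leq_subr.
      by rewrite in_itv /= (le_trans s0 (ltW sx)) ltW.
    apply: (@le_trans _ _ (n.+1%:R * l ^+ i.+1 * U x ^+ (n - i))).
      rewrite ler_pM ?mulr_ge0 ?modC_ge0// ler_pM ?modC_ge0//.
      by rewrite ler_nat ltnS leq_subr.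
    have -> : n.+1%:R * U x ^+ n * (2 * l) * 2^-1 ^+ i.+1 =
        n.+1%:R * (l ^+ i.+1 * (1 + tpi - x) ^+ i) * U x ^+ (n - i).
      rewrite -[X in _ * U x ^+ X * (2 * l)](subnK iN) exprD.
      rewrite (_ : U x ^+ i = 2 ^+ i * l ^+ i * (1 + tpi - x) ^+ i); last first.
        by rewrite /U !exprMn.
      rewrite !exprS exprVn; field.
      by rewrite expf_neq0.
    rewrite ler_wpM2r ?exprn_ge0// ler_wpM2l//.
    by rewrite ler_peMr ?exprn_ege1// exprn_ge0// ltW.
  rewrite -big_distrr /= geo_half_sum ler_piMr//.
  by rewrite mulr_ge0 ?mulr_ge0 ?exprn_ge0// ltW.
rewrite opprK addrC gerBl exprn_ge0//.
by rewrite /U addrK !mulr_ge0// ltW.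
Qed.

Lemma flow_coef_bound a : exists2 B : R, 0 < B &
  {ae mu, forall x, forall n, modC (a n x) <= B ^+ n.+1} /\
  forall n s, s \in `[0, tpi] -> modC (flow_coef a n s) <= B ^+ n.
Proof.
have [l l0 la] := X_bound a; have t0 := twopi_gt0 R.
have t1 : 0 <= 1 + tpi by rewrite addr_ge0// ltW.
have B0 : 0 < 2 * l * (1 + tpi) by rewrite !mulr_gt0// ltr_wpDr// ltW.
exists (2 * l * (1 + tpi)) => //; split.
  apply/ae_foralln => n; apply: (aeS _ (la n)) => x /le_trans; apply.
  apply: lerXn2r; rewrite ?nnegrE ?(ltW l0) ?(ltW B0)//.
  by rewrite mulrAC ler_peMl ?(ltW l0)//; lra.
move=> n s sp; apply: le_trans (flow_coef_le l0 la n sp) _.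
move: sp; rewrite in_itv /= => /andP[s0 st].
apply: lerXn2r; rewrite ?nnegrE ?(ltW B0)//.
  by rewrite !mulr_ge0 ?(ltW l0)//; lra.
by rewrite ler_wpM2l ?mulr_ge0 ?(ltW l0)// gerBl.
Qed.

End ReturnCoefficients.

(** * Measurable complex functions *)

Section MeasurableC.
Variable R : realType.
Implicit Types (D : set R) (f g : R -> CC R).

Definition measC D f : Prop :=
  measurable_fun D (fun t => reC (f t)) /\ measurable_fun D (fun t => imC (f t)).

Lemma measC_cst D c : measC D (fun=> c).
Proof. by split; exact: measurable_cst. Qed.

Lemma measCD D f g : measC D f -> measC D g -> measC D (fun t => f t + g t).
Proof.
move=> [fr fi] [gr gi]; split.
  by under [X in measurable_fun _ X]funext do rewrite reCD; exact: measurable_funD.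
by under [X in measurable_fun _ X]funext do rewrite imCD; exact: measurable_funD.
Qed.

Lemma measCM D f g : measC D f -> measC D g -> measC D (fun t => f t * g t).
Proof.
move=> [fr fi] [gr gi]; split.
  under [X in measurable_fun _ X]funext do rewrite reCM.
  by apply: measurable_funB; exact: measurable_funM.
under [X in measurable_fun _ X]funext do rewrite imCM.
by apply: measurable_funD; exact: measurable_funM.
Qed.

Lemma measCX D f n : measC D f -> measC D (fun t => f t ^+ n).
Proof.
move=> mf; elim: n => [|n IH]; first exact: measC_cst.
by under [X in measC _ X]funext do rewrite exprS; exact: measCM.
Qed.

Lemma measC_sum D (F : nat -> R -> CC R) n : (forall i, (i < n)%N -> measC D (F i)) ->
  measC D (fun t => \sum_(0 <= i < n) F i t).
Proof.
elim: n => [_|n IH mF].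
  by under [X in measC _ X]funext do rewrite big_geq//; exact: measC_cst.
under [X in measC _ X]funext do rewrite big_nat_recr//=.
by apply: measCD; [apply: IH => i iN; apply: mF; exact: ltnW|exact: mF].
Qed.

Lemma measC_lim D (F : nat -> R -> CC R) f : (forall n, measC D (F n)) ->
  (forall x, D x -> (fun n => F n x) @ \oo --> f x) -> measC D f.
Proof.
move=> mF Ff; split.
  apply: (measurable_fun_cvg (h := fun n x => reC (F n x))).
    by move=> n; exact: (mF n).1.
  by move=> x Dx; have /cvgC_reim[] := Ff x Dx.
apply: (measurable_fun_cvg (h := fun n x => imC (F n x))).
  by move=> n; exact: (mF n).2.
by move=> x Dx; have /cvgC_reim[] := Ff x Dx.
Qed.

End MeasurableC.

(** * Picard iteration *)

Section Picard.
Variable R : realType.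
Local Notation mu := (@lebesgue_measure R).
Variables (T rho M L : R) (r : CC R) (F : R -> CC R -> CC R).
Hypotheses (T0 : 0 <= T) (rr : modC r <= rho / 2).
Hypotheses (TM : M * T <= rho / 2) (TL : L * T <= 2^-1).
Hypotheses (M0 : 0 <= M) (L0 : 0 <= L).
Hypothesis FM : forall t z, modC z <= rho -> modC (F t z) <= M.
Hypothesis FL : forall t z w, modC z <= rho -> modC w <= rho ->
  modC (F t z - F t w) <= L * modC (z - w).

Let good (v : R -> CC R) := measC `[0, T]%classic v /\
  forall x, x \in `[0, T] -> modC (v x) <= rho.

Hypothesis Fmeas : forall v, good v -> measC `[0, T]%classic (fun t => F t (v t)).

Let W (v : R -> CC R) (x : R) : CC R := r + intC `[0, x] (fun t => F t (v t)).

Let W_prim v : good v -> primitive 0 T (W v) (fun t => F t (v t)).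
Proof.
move=> gv; have [mr mi] := Fmeas gv.
have bm : bounded_measurable 0 T (fun t => F t (v t)).
  split => //; exists M; apply: aeW => x xT; apply: FM; apply: gv.2.
  exact: subset_itv_oo_cc xT.
have := primitiveD (primitive_cst 0 T r) (primitive_intC bm).
by apply: primitive_eq_in => //; apply: aeW => x _; rewrite add0r.
Qed.

Let W0 v : W v 0 = r.
Proof. by rewrite /W intC_set1 addr0. Qed.

Let W_good v : good v -> good (W v).
Proof.
move=> gv; have PW := W_prim gv; split; first exact: (lipC_measurable PW.1).
move=> x; rewrite in_itv /= => /andP[x0 xT].
rewrite -[W v x](subrK (W v 0)); apply: le_trans (modCD _ _) _.
have : modC (W v x - W v 0) <= M * (x - 0).
  apply: primitive_bound => //; first exact: primitive_sub PW.
  apply: aeW => y; rewrite in_itv /= => /andP[y0 yx]; apply: FM; apply: gv.2.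
  by rewrite in_itv /= (ltW y0) (le_trans (ltW yx)).
rewrite W0 subr0 => H; rewrite [rho]splitr lerD//; apply: le_trans H _.
by apply: le_trans TM; rewrite ler_wpM2l.
Qed.

Let W_contract v w e : good v -> good w ->
  (forall x, x \in `[0, T] -> modC (v x - w x) <= e) ->
  forall x, x \in `[0, T] -> modC (W v x - W w x) <= e / 2.
Proof.
move=> gv gw vw x; rewrite in_itv /= => /andP[x0 xT].
have e0 : 0 <= e.
  by apply: le_trans (modC_ge0 _) (vw 0 _); rewrite bound_itvE.
have P := primitiveD (W_prim gv) (primitiveN (W_prim gw)).
have : modC ((W v x - W w x) - (W v 0 - W w 0)) <= (L * e) * (x - 0).
  apply: (primitive_bound (g := fun x => W v x - W w x)) => //.
    exact: primitive_sub P.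
  apply: aeW => y; rewrite in_itv /= => /andP[y0 yx].
  have yT : y \in `[0, T] by rewrite in_itv /= (ltW y0) (le_trans (ltW yx)).
  apply: le_trans (FL _ _ _) _; [exact: gv.2|exact: gw.2|].
  by rewrite ler_wpM2l// vw.
rewrite !W0 subrr !subr0 => /le_trans; apply.
apply: (@le_trans _ _ (L * T * e)).
  by rewrite mulrAC ler_wpM2r// ler_wpM2l.
by rewrite mulrC ler_wpM2l.
Qed.

(** The map W is a contraction of ratio 1/2 for the uniform distance: the iterates
    converge pointwise, with geometric bounds that are uniform in x, and the
    limit is a fixed point of W. *)
Theorem picard : exists2 v : R -> CC R, v 0 = r &
  primitive 0 T v (fun t => F t (v t)) /\
  forall x, x \in `[0, T] -> modC (v x) <= rho.
Proof.
pose v_ := fix v_ k := if k is k'.+1 then W (v_ k') else fun=> r.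
have rho0 : 0 <= rho by move: rr (modC_ge0 r); lra.
have gv k : good (v_ k).
  elim: k => [|k IH]; last exact: W_good.
  by split; [exact: measC_cst|move=> x _ /=; move: rr rho0; lra].
pose u x k := v_ k.+1 x - v_ k x.
have uE x k : x \in `[0, T] -> modC (u x k) <= 2 * rho * 2^-1 ^+ k.
  elim: k x => [|k IH] x xT.
    rewrite expr0 mulr1; apply: le_trans (modCB _ _) _.
    by rewrite mulr_natl mulr2n lerD// (gv _).2.
  rewrite exprSr mulrA; exact: (W_contract (gv k.+1) (gv k) IH).
have q2 : 0 <= (2^-1 : R) <= 2^-1 by rewrite invr_ge0 ler0n lexx.
have rho2 : 0 <= 2 * rho by rewrite mulr_ge0.
have uS x k : series (u x) k = v_ k x - r.
  by rewrite /series /=; exact: (@telescope_sumr _ 0 k (fun k => v_ k x)).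
pose v x := r + xget 0 [set s | series (u x) @ \oo --> s].
have vS x : x \in `[0, T] -> series (u x) @ \oo --> v x - r.
  move=> xT; have [s sP] := geo_cvg rho2 q2 (fun k => uE x k xT).
  have -> : v x - r = xget 0 [set s | series (u x) @ \oo --> s].
    by rewrite /v addrAC subrr add0r.
  exact: (xgetI (P := [set s | series (u x) @ \oo --> s]) 0 sP).
have vv x k : x \in `[0, T] -> modC (v x - v_ k x) <= 2 * (2 * rho) * 2^-1 ^+ k.
  move=> xT; have := geo_tail rho2 q2 (fun k => uE x k xT) k (vS x xT).
  by rewrite uS opprB addrA subrK.
have vc x : x \in `[0, T] -> (fun k => v_ k x) @ \oo --> v x.
  move=> xT; apply: cvgC_squeeze (fun k => vv x k xT) _; exact: half_pow_cvg0.
have gv' : good v.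
  split.
    by apply: measC_lim (fun k => (gv k).1) _ => // x xT; exact: vc.
  move=> x xT; apply: cvgC_le (vc x xT) => k; exact: (gv k).2.
have Wv x : x \in `[0, T] -> W v x = v x.
  move=> xT; apply: (@cvgC_unique _ (fun k => v_ k.+1 x)); last first.
    by have := vc x xT; rewrite -(cvg_shiftS (fun k => v_ k x)).
  apply: (@cvgC_squeeze _ _ _ (fun k => 2 * (2 * rho) * 2^-1 ^+ k / 2)).
    move=> k; apply: (W_contract gv' (gv k) _ xT) => y; exact: vv.
  under [X in X @ _ --> _]funext do rewrite mulrAC.
  exact: half_pow_cvg0.
exists (W v); first exact: W0.
split; last by move=> x xT; rewrite Wv// gv'.2.
apply: primitive_eq_in (W_prim gv') => //.
by apply: aeW => x xT; rewrite Wv//; exact: subset_itv_oo_cc xT.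
Qed.

End Picard.

(** * Solutions with small initial value *)

Section Equation.
Variable R : realType.
Local Notation mu := (@lebesgue_measure R).
Local Notation tpi := (twopi R).
Implicit Types (a b : X R) (r : CC R) (v h : R -> CC R).

Local Notation eq_terms a v x := (fun n => a n x * v x ^+ n.+2).

Lemma ode_primitive a r v : ode_solution a r v -> v 0 = r /\
  exists h, primitive 0 tpi v h /\
    {ae mu, forall x, x \in `]0, tpi[ -> series (eq_terms a v x) @ \oo --> h x}.
Proof.
move=> [v0 lv dv]; split => //.
pose good x := [set s | series (eq_terms a v x) @ \oo --> s /\ der v x s].
have H : {ae mu, forall x, x \in `]0, tpi[ -> good x (xget 0 (good x))}.
  apply: (aeS _ dv) => x D xp; have [s [s1 s2 s3]] := D xp.
  by apply: (xgetI (P := good x) 0 (x := s)); split => //; split.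
exists (fun x => xget 0 (good x)); split.
  by split => //; apply: (aeS _ H) => x D xp; case: (D xp).
by apply: (aeS _ H) => x D xp; case: (D xp).
Qed.

Lemma primitive_ode a r v h : v 0 = r -> primitive 0 tpi v h ->
  {ae mu, forall x, x \in `]0, tpi[ -> series (eq_terms a v x) @ \oo --> h x} ->
  ode_solution a r v.
Proof.
move=> v0 [lv dv] hv; split => //; apply: (aeS2 _ dv hv) => x D S xp.
by have [D1 D2] := D xp; exists (h x); split => //; exact: S.
Qed.

Lemma eq_term_le (B rho : R) (c : nat -> CC R) (z : CC R) i : 0 <= B ->
  (forall n, modC (c n) <= B ^+ n.+1) -> modC z <= rho ->
  modC (c i * z ^+ i.+2) <= (B * rho ^+ 2) * (B * rho) ^+ i.
Proof.
move=> B0 cB zr; rewrite modCM modCX.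
have -> : B * rho ^+ 2 * (B * rho) ^+ i = B ^+ i.+1 * rho ^+ i.+2.
  by rewrite exprMn !exprS; ring.
apply: ler_pM => //; rewrite ?exprn_ge0 ?modC_ge0//.
apply: lerXn2r => //; rewrite nnegrE ?modC_ge0//.
exact: le_trans (modC_ge0 _) zr.
Qed.

(** A continuation argument by steps: a Lipschitz function needs a time at least d
    to grow from rho' to rho. *)
Lemma lip_stays_small (T rho rho' : R) v : rho' < rho -> lipC 0 T v ->
  (forall c, c \in `[0, T] -> (forall y, y \in `[0, c] -> modC (v y) <= rho) ->
     modC (v c) <= rho') ->
  modC (v 0) <= rho ->
  forall x, x \in `[0, T] -> modC (v x) <= rho.
Proof.
move=> rr /lipC_ge0[k k0 lv] H v0.
pose d := (rho - rho') / (k + 1).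
have k1 : 0 < k + 1 by rewrite ltr_wpDl.
have d0 : 0 < d by rewrite divr_gt0// subr_gt0.
suff S n x : x \in `[0, T] -> x <= n%:R * d -> modC (v x) <= rho.
  move=> x xT; apply: (S (Num.truncn (x / d)).+1 x xT).
  by rewrite -ler_pdivrMr// ltW// truncnS_gt.
elim: n x => [|n IH] x xT xn.
  move: xT xn; rewrite mul0r in_itv /= => /andP[x0 _] x0'.
  by rewrite (@le_anti _ _ x 0) ?x0 ?x0'.
have [xn'|nx] := leP x (n%:R * d); first exact: IH.
have nd0 : 0 <= n%:R * d by rewrite mulr_ge0// ltW.
move: xT; rewrite in_itv /= => /andP[x0 xT].
have yT : n%:R * d \in `[0, T] by rewrite in_itv /= nd0 (le_trans (ltW nx)).
have vy : modC (v (n%:R * d)) <= rho'.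
  apply: H => // y; rewrite in_itv /= => /andP[y0 yn]; apply: IH => //.
  by rewrite in_itv /= y0 (le_trans yn)// (le_trans (ltW nx)).
rewrite -[v x](subrK (v (n%:R * d))); apply: le_trans (modCD _ _) _.
rewrite -[rho](subrK rho') lerD//.
apply: le_trans (lv _ _ _ yT) _; first by rewrite in_itv /= x0.
rewrite ger0_norm ?subr_ge0 ?(ltW nx)//.
apply: (@le_trans _ _ (k * d)).
  by rewrite ler_wpM2l// lerBlDr; move: xn; rewrite -natr1 mulrDl mul1r addrC.
rewrite /d mulrA ler_pdivrMr// mulrC ler_wpM2l ?subr_ge0 ?(ltW rr)//.
by rewrite lerDl.
Qed.

Section Small.
Variables (a : X R) (B rho : R).
Hypotheses (B0 : 0 < B) (rho0 : 0 < rho).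
Hypothesis aB : {ae mu, forall x, forall n, modC (a n x) <= B ^+ n.+1}.
Hypotheses (Brho : B * rho <= 8^-1) (Brhot : 8 * tpi * (B * rho) <= 1).

Let Br0 : 0 <= B * rho. Proof. by rewrite mulr_ge0 ?ltW. Qed.
Let Br2 : 0 <= B * rho <= 2^-1. Proof. by rewrite Br0 /=; move: Brho; lra. Qed.
Let C0 : 0 <= B * rho ^+ 2. Proof. by rewrite mulr_ge0 ?exprn_ge0 ?ltW. Qed.

(* The left-hand side bounds the variation of a solution that stays in the disc
   of radius rho. *)
Let speed : 2 * (B * rho ^+ 2) * tpi <= rho / 4.
Proof.
have -> : 2 * (B * rho ^+ 2) * tpi = rho / 4 * (8 * tpi * (B * rho)) by field.
by rewrite ler_piMr// divr_ge0// ltW.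
Qed.

(** While |v| <= rho the speed is at most 2 B rho^2, so that v cannot leave the
    disc of radius 3 rho / 4 before time 2 pi. *)
Lemma ode_small r v : modC r <= rho / 2 -> ode_solution a r v ->
  forall x, x \in `[0, tpi] -> modC (v x) <= rho.
Proof.
move=> rr /ode_primitive[v0 [h [Pv hv]]].
apply: (@lip_stays_small _ _ (rho / 2 + rho / 4)); last 1 first.
- by rewrite v0; apply: le_trans rr _; move: rho0; lra.
- by move: rho0; lra.
- exact: Pv.1.
move=> c; rewrite in_itv /= => /andP[c0 ct] vc.
rewrite -[v c](subrK (v 0)) addrC; apply: le_trans (modCD _ _) _.
rewrite {1}v0 lerD//; apply: (@le_trans _ _ (2 * (B * rho ^+ 2) * (c - 0))).
  apply: primitive_bound => //; first exact: primitive_sub Pv.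
  apply: (aeS2 _ aB hv) => x ax hx; rewrite in_itv /= => /andP[x0 xc].
  have xt : x \in `]0, tpi[ by rewrite in_itv /= x0 (lt_le_trans xc).
  have vx : modC (v x) <= rho by apply: vc; rewrite in_itv /= !ltW.
  exact: (geo_bound C0 Br2 (fun i => eq_term_le i (ltW B0) ax vx) (hx xt)).
apply: le_trans speed; rewrite subr0 ler_wpM2l// mulr_ge0//.
Qed.

(** Picard iteration applies to the coefficients truncated at their a.e. bounds:
    these define a vector field at every time, and the solutions are the same. *)
Lemma ode_exists r : modC r <= rho / 2 -> exists v, ode_solution a r v.
Proof.
move=> rr.
pose b n x : CC R := if modC (a n x) <= B ^+ n.+1 then a n x else 0.
have bB x n : modC (b n x) <= B ^+ n.+1.
  by rewrite /b; case: ifP => // _; rewrite modC0 exprn_ge0// ltW.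
have ab : {ae mu, forall x, forall n, a n x = b n x}.
  by apply: (aeS _ aB) => x H n; rewrite /b H.
have mb n : measC setT (b n).
  have [ha _] := XP a; have [_ ra ia] := ha n.
  have mm : measurable_fun setT (fun x => modC (a n x) <= B ^+ n.+1).
    apply: measurable_fun_ler; last exact: measurable_cst.
    rewrite (_ : (fun x => modC (a n x)) = fun x =>
      Num.sqrt (reC (a n x) ^+ 2 + imC (a n x) ^+ 2)); last first.
      by apply/funext => x; rewrite -modC_sqr sqrtr_sqr ger0_norm// modC_ge0.
    apply: measurableT_comp; first exact: (continuous_measurable_fun (@sqrt_continuous R)).
    by apply: measurable_funD; exact: measurable_funX.
  split.
    rewrite (_ : (fun x => _) = fun x => if modC (a n x) <= B ^+ n.+1 then reC (a n x) else 0).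
      by apply: measurable_fun_ifT => //; exact: measurable_cst.
    by apply/funext => x; rewrite /b; case: ifP.
  rewrite (_ : (fun x => _) = fun x => if modC (a n x) <= B ^+ n.+1 then imC (a n x) else 0).
    by apply: measurable_fun_ifT => //; exact: measurable_cst.
  by apply/funext => x; rewrite /b; case: ifP.
pose F t z : CC R := xget 0 [set s | series (fun n => b n t * z ^+ n.+2) @ \oo --> s].
have FS t z : modC z <= rho -> series (fun n => b n t * z ^+ n.+2) @ \oo --> F t z.
  move=> zr; have [s sP] := geo_cvg C0 Br2 (fun i => eq_term_le i (ltW B0) (bB t) zr).
  exact: (xgetI (P := [set s | series (fun n => b n t * z ^+ n.+2) @ \oo --> s]) 0 sP).
have FM t z : modC z <= rho -> modC (F t z) <= 2 * (B * rho ^+ 2).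
  move=> zr; exact: (geo_bound C0 Br2 (fun i => eq_term_le i (ltW B0) (bB t) zr) (FS t z zr)).
have FL t z w : modC z <= rho -> modC w <= rho ->
    modC (F t z - F t w) <= 2 * (2 * (B * rho)) * modC (z - w).
  move=> zr wr.
  have S : series (fun n => b n t * z ^+ n.+2 - b n t * w ^+ n.+2) @ \oo --> F t z - F t w.
    have -> : series (fun n => b n t * z ^+ n.+2 - b n t * w ^+ n.+2) =
        fun n => series (fun n => b n t * z ^+ n.+2) n - series (fun n => b n t * w ^+ n.+2) n.
      by apply/funext => n; rewrite /series /= sumrB.
    exact: (cvgB (FS t z zr) (FS t w wr)).
  rewrite -mulrA; apply: (geo_bound (q := 2 * (B * rho)) _ _ _ S).
  - by apply: mulr_ge0; [exact: mulr_ge0|exact: modC_ge0].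
  - by rewrite mulr_ge0//=; move: Brho; lra.
  (* The terms are dominated because i + 2 <= 2 ^ (i + 1). *)
  move=> i; rewrite -mulrBr modCM.
  have P n : modC (z ^+ n.+1 - w ^+ n.+1) <= n.+1%:R * rho ^+ n * modC (z - w).
    elim: n => [|n IH]; first by rewrite mul1r expr0 mul1r.
    have -> : z ^+ n.+2 - w ^+ n.+2 = z * (z ^+ n.+1 - w ^+ n.+1) + (z - w) * w ^+ n.+1.
      by rewrite (exprS z n.+1) (exprS w n.+1); ring.
    apply: le_trans (modCD _ _) _; rewrite !modCM modCX.
    have -> : n.+2%:R * rho ^+ n.+1 * modC (z - w) =
        rho * (n.+1%:R * rho ^+ n * modC (z - w)) + modC (z - w) * rho ^+ n.+1.
      by rewrite -[in LHS]natr1 exprS; ring.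
    apply: lerD; first by apply: ler_pM; rewrite ?modC_ge0.
    apply: ler_wpM2l; rewrite ?modC_ge0//.
    by apply: lerXn2r => //; rewrite nnegrE ?modC_ge0// ltW.
  apply: (@le_trans _ _ (B ^+ i.+1 * (2 ^+ i.+1 * rho ^+ i.+1 * modC (z - w)))).
    rewrite ler_pM ?modC_ge0//; apply: le_trans (P _) _.
    rewrite ler_wpM2r ?modC_ge0// ler_wpM2r ?exprn_ge0 ?(ltW rho0)//.
    by rewrite -natrX ler_nat ltn_expl.
  by rewrite le_eqVlt; apply/orP; left; apply/eqP; rewrite !exprMn !exprS; ring.
have [v v0 [Pv vr]] : exists2 v, v 0 = r & primitive 0 tpi v (fun t => F t (v t)) /\
    forall x, x \in `[0, tpi] -> modC (v x) <= rho.
  apply: (@picard R tpi rho (2 * (B * rho ^+ 2)) (2 * (2 * (B * rho)))) => //.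
  - exact/ltW/twopi_gt0.
  - by apply: le_trans speed _; rewrite ler_pM2l// lef_pV2 ?posrE// ler_nat.
  - have -> : 2 * (2 * (B * rho)) * tpi = 2^-1 * (8 * tpi * (B * rho)) by field.
    by rewrite ler_piMr// invr_ge0.
  - exact: mulr_ge0.
  - by do 2![apply: mulr_ge0 => //].
  move=> v [mv vr].
  apply: (@measC_lim _ _ (fun n t => series (fun n => b n t * v t ^+ n.+2) n)).
    move=> n; apply: (measC_sum (F := fun n t => b n t * v t ^+ n.+2)) => i _.
    apply: measCM; last exact: measCX.
    by split; [apply: measurable_funS (mb i).1|apply: measurable_funS (mb i).2].
  by move=> x xT; apply: FS; exact: vr.
exists v; apply: (primitive_ode v0 Pv).
apply: (aeS _ ab) => x abx xt.
have -> : eq_terms a v x = fun n => b n x * v x ^+ n.+2.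
  by apply/funext => n; rewrite abx.
by apply: FS; apply: vr; exact: subset_itv_oo_cc xt.
Qed.

End Small.

End Equation.

(** * The series that is constant along solutions *)

Section Expansion.
Variable R : realType.
Local Notation mu := (@lebesgue_measure R).
Local Notation tpi := (twopi R).
Implicit Types (a b : X R) (r : CC R) (v h : R -> CC R).

Lemma triangle_exchange (V : nmodType) (T : nat -> nat -> V) N :
  \sum_(n < N) \sum_(i < n.+1) T i (n - i)%N = \sum_(m < N) \sum_(i < N - m) T i m.
Proof.
elim: N => [|N IH]; first by rewrite !big_ord0.
rewrite big_ord_recr IH /= [RHS]big_ord_recr /= subSnn big_ord1 /=.
have -> : \sum_(m < N) \sum_(i < N.+1 - m) T i m =
    \sum_(m < N) \sum_(i < N - m) T i m + \sum_(m < N) T (N - m)%N m.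
  rewrite -big_split; apply: eq_bigr => m _ /=.
  by rewrite subSn ?(ltnW (ltn_ord m))// big_ord_recr.
rewrite -addrA; congr (_ + _).
have -> : \sum_(m < N) T (N - m)%N m + T 0%N N = \sum_(m < N.+1) T (N - m)%N m.
  by rewrite [RHS]big_ord_recr /= subnn.
rewrite (reindex_inj rev_ord_inj) /=; apply: eq_bigr => i _.
by rewrite subSS subKn// -ltnS.
Qed.

Section Converges.
Variables (a : X R) (B rho : R) (r : CC R) (v : R -> CC R).
Hypotheses (B0 : 0 < B) (rho0 : 0 < rho).
Hypothesis aB : {ae mu, forall x, forall n, modC (a n x) <= B ^+ n.+1}.
Hypothesis phiB : forall n s, s \in `[0, tpi] -> modC (flow_coef a n s) <= B ^+ n.
Hypotheses (Brho : B * rho <= 8^-1).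
Hypotheses (av : ode_solution a r v) (vr : forall x, x \in `[0, tpi] -> modC (v x) <= rho).

Local Notation phi := (flow_coef a).

(** Truncations of the series that is constant along the solutions. *)
Let G N x := \sum_(n < N.+1) phi n x * v x ^+ n.+1.

(** By the transport equation the derivative of G N keeps only the terms of degree
    greater than N + 1.  There are N + 1 sums of them, each with a factor at most
    N + 1 and of size at most 2 B rho^2 (B rho)^N; the condition B rho <= 1/8
    absorbs (N + 1)^2 <= 4^N. *)
Lemma truncated_first_integral N :
  modC (G N tpi - G N 0) <= 2 * (B * rho ^+ 2) * 2^-1 ^+ N * tpi.
Proof.
have [v0 [h [Pv hv]]] := ode_primitive av.
have Br0 : 0 <= B * rho by rewrite mulr_ge0 ?ltW.
have Br2 : 0 <= B * rho <= 2^-1 by rewrite Br0 /=; move: Brho; lra.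
have C0 : 0 <= B * rho ^+ 2 by rewrite mulr_ge0 ?exprn_ge0 ?ltW.
pose dphi n t := if n is n'.+1 then
  - \sum_(i < n'.+1) (n' - i).+1%:R * a i t * phi (n' - i)%N t else 0 : CC R.
have Pphi n : primitive 0 tpi (phi n) (dphi n).
  case: n => [|n]; last exact: flow_coef_primitive.
  rewrite (_ : phi 0%N = fun=> 1); first exact: primitive_cst.
  by apply/funext => s; rewrite flow_coef0.
pose D x := \sum_(n < N.+1)
  (dphi n x * v x ^+ n.+1 + phi n x * (n.+1%:R * v x ^+ n * h x)).
have PG : primitive 0 tpi (G N) D.
  have := @primitive_sum R _ (index_enum 'I_N.+1) 0 tpi
    (fun n x => phi n x * v x ^+ n.+1)
    (fun n x => dphi n x * v x ^+ n.+1 + phi n x * (n.+1%:R * v x ^+ n * h x)).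
  by apply => n; apply: primitiveM => //; exact: primitiveX.
pose T x (i m : nat) := m.+1%:R * phi m x * v x ^+ m * (a i x * v x ^+ i.+2).
have DE x : D x = \sum_(m < N.+1)
    m.+1%:R * phi m x * v x ^+ m * (h x - series (fun i => a i x * v x ^+ i.+2) (N - m)%N).
  rewrite /D big_split /=.
  have -> : \sum_(n < N.+1) dphi n x * v x ^+ n.+1 =
      - \sum_(n < N) \sum_(i < n.+1) T x i (n - i)%N.
    rewrite big_ord_recl /= mul0r add0r -sumrN; apply: eq_bigr => n _.
    rewrite /dphi /= mulNr big_distrl; congr (- _); apply: eq_bigr => i _ /=.
    rewrite /T -[X in v x ^+ X](_ : (n - i) + i.+2 = _)%N; last first.
      by rewrite !addnS subnK// -ltnS.
    by rewrite exprD; ring.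
  rewrite triangle_exchange addrC.
  have -> : \sum_(m < N) \sum_(i < N - m) T x i m =
      \sum_(m < N.+1) \sum_(i < N - m) T x i m.
    by rewrite big_ord_recr /= subnn big_ord0 addr0.
  rewrite -sumrB; apply: eq_bigr => m _; rewrite mulrBr; congr (_ - _); first ring.
  by rewrite /series /= big_mkord big_distrr.
have t0 := ltW (twopi_gt0 R).
rewrite -[X in _ * X](subr0 tpi); apply: primitive_bound PG _ => //.
apply: (aeS2 _ aB hv) => x ax hx xt.
have xt' : x \in `[0, tpi] by exact: subset_itv_oo_cc xt.
rewrite DE; apply: le_trans (modC_sum _ _ _) _.
have [K KE] : exists K, K = 2 * (B * rho ^+ 2) by eexists.
have K0 : 0 <= K by rewrite KE mulr_ge0.
rewrite -KE.
apply: (@le_trans _ _ (\sum_(m < N.+1) (N.+1%:R * (K * (B * rho) ^+ N)))).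
  apply: ler_sum => m _; have mN : (m <= N)%N by rewrite -ltnS.
  have tail := geo_tail C0 Br2 (fun i => eq_term_le i (ltW B0) ax (vr xt'))
     (N - m)%N (hx xt).
  rewrite -KE in tail.
  rewrite !modCM modC_nat modCX -!mulrA; apply: ler_pM => //.
    by rewrite !mulr_ge0 ?exprn_ge0 ?modC_ge0.
    by rewrite ler_nat ltnS.
  rewrite mulrA; apply: (@le_trans _ _ ((B * rho) ^+ m * (K * (B * rho) ^+ (N - m)))).
    apply: ler_pM => //; rewrite ?mulr_ge0 ?exprn_ge0 ?modC_ge0//.
    rewrite exprMn; apply: ler_pM; rewrite ?exprn_ge0 ?modC_ge0//; first exact: phiB.
    by apply: lerXn2r; rewrite ?nnegrE ?modC_ge0 ?(ltW rho0)//; exact: vr.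
  by rewrite mulrCA -exprD subnKC.
rewrite sumr_const card_ord -[_ *+ N.+1]mulr_natl.
have -> : N.+1%:R * (N.+1%:R * (K * (B * rho) ^+ N)) =
  K * ((B * rho) ^+ N * (N.+1%:R * N.+1%:R)) by ring.
have N2 : N.+1%:R <= 2 ^+ N :> R by rewrite -natrX ler_nat ltn_expl.
rewrite ler_wpM2l//.
apply: (@le_trans _ _ (8^-1 ^+ N * (2 ^+ N * 2 ^+ N))).
  apply: ler_pM; [exact: exprn_ge0|exact: mulr_ge0| |exact: ler_pM].
  by apply: lerXn2r Brho; rewrite nnegrE// invr_ge0.
by rewrite -!exprMn (_ : 8^-1 * (2 * 2) = 2^-1)//; field.
Qed.

(** At time 0 the truncations are the partial sums at r, and at time 2 pi only the
    term v(2 pi) remains. *)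
Theorem ode_expansion :
  series (ps_terms (fun n => phi n.+1 0) r) @ \oo --> v tpi - r.
Proof.
have [v0 _] := ode_primitive av.
pose b N := 2 * (B * rho ^+ 2) * tpi * 2^-1 ^+ N.
apply: (@cvgC_squeeze _ _ _ b); last exact: half_pow_cvg0.
move=> N; have := truncated_first_integral N.
rewrite [in leRHS]mulrAC -/(b N); congr (modC _ <= _).
rewrite /G !big_ord_recl /= !flow_coef0 !mul1r !expr1 v0.
rewrite big1 => [|i _]; last by rewrite flow_coef_twopi mul0r.
by rewrite addr0 opprD addrA /series /= big_mkord.
Qed.

End Converges.

End Expansion.

(** * Convergent power series *)

Section PowerSeries.
Variable R : realType.
Implicit Types (d : nat -> CC R) (z : CC R) (f g : Gc R).

Lemma near0CP (P : CC R -> Prop) : (\forall z \near (0 : CC R), P z) <->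
  exists2 e : R, 0 < e & forall z, modC z < e -> P z.
Proof.
split=> [/nbhs_ballP[e /= e0 H]|[e e0 H]].
  move: e0; rewrite ltcE => /andP[/= im0 re0].
  exists (reC e) => // z ze; apply: H; rewrite /ball /= sub0r normrN normCE.
  have -> : e = realC (reC e) by apply: reim_eq => //=; exact/eqP.
  by rewrite realC_lt.
apply/nbhs_ballP; exists (realC e); first by rewrite /= -[0]/(realC 0) realC_lt.
by move=> z; rewrite /ball /= sub0r normrN normCE realC_lt => /H.
Qed.

Definition geometric_growth d := exists2 B : R, 0 < B & forall n, modC (d n) <= B ^+ n.+1.

Lemma ps_term_cvg d (B rho : R) z : 0 < B -> B * rho <= 2^-1 -> 0 <= rho ->
  (forall n, modC (d n) <= B ^+ n.+1) -> modC z <= rho ->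
  exists s : CC R, series (ps_terms d z) @ \oo --> s.
Proof.
move=> B0 Br r0 dB zr; have Br0 : 0 <= B * rho by rewrite mulr_ge0// ltW.
apply: (geo_cvg (C := B * rho ^+ 2) (q := B * rho)).
- by apply: mulr_ge0; [exact: ltW|exact: exprn_ge0].
- by rewrite Br0.
- by move=> i; apply: eq_term_le => //; exact: ltW.
Qed.

Lemma geometric_convergent d : geometric_growth d -> convergent_ps d.
Proof.
move=> [B B0 dB]; apply/near0CP; exists ((2 * B)^-1); first by rewrite invr_gt0 mulr_gt0.
move=> z /ltW zr; apply/cvg_ex; apply: (ps_term_cvg B0 _ _ dB zr).
  by rewrite invfM mulrCA divff ?mulr1 ?gt_eqF.
by rewrite invr_ge0 mulr_ge0// ltW.
Qed.

(** The terms of a series that converges at a real number e > 0 are bounded. *)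
Lemma convergent_geometric d : convergent_ps d -> geometric_growth d.
Proof.
move=> /near0CP[e0 e00 H].
pose e := e0 / 2.
have ep : 0 < e by rewrite divr_gt0.
have /cvg_ex[/= s sP] : cvgn (series (ps_terms d (realC e))).
  by apply: H; rewrite modC_realC gtr0_norm// /e ltr_pdivrMr// ltr_pMr// ltr1n.
have [N _ HN] := (cvgCP _ _).1 sP 1 ltr01.
have [K K0 HK] : exists2 K : R, 1 <= K & forall n, modC (d n) * e ^+ n.+2 <= K.
  have S0 : 0 <= \sum_(i < N) modC (d i) * e ^+ i.+2.
    by apply: sumr_ge0 => i _; rewrite mulr_ge0 ?modC_ge0// exprn_ge0// ltW.
  exists (2 + \sum_(i < N) modC (d i) * e ^+ i.+2).
    by apply: (@le_trans _ _ 2); rewrite ?ler1n// lerDl.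
  move=> n; have [nN|Nn] := ltnP n N.
    rewrite (bigD1 (Ordinal nN)) //= addrCA lerDl addr_ge0// sumr_ge0// => i _.
    by rewrite mulr_ge0 ?modC_ge0// exprn_ge0// ltW.
  have -> : modC (d n) * e ^+ n.+2 = modC (ps_terms d (realC e) n).
    by rewrite /ps_terms modCM modCX modC_realC gtr0_norm.
  have -> : ps_terms d (realC e) n =
      (s - series (ps_terms d (realC e)) n) - (s - series (ps_terms d (realC e)) n.+1).
    by rewrite /series /= big_nat_recr //=; ring.
  apply: le_trans (modCB _ _) _.
  have := HN n Nn; have := HN n.+1 (leqW Nn) => /= h1 h2.
  by rewrite -[leLHS]addr0 lerD// -[2]/(1 + 1) lerD// ltW.
pose m := Num.max 1 e^-1.
have m1 : 1 <= m by rewrite le_max lexx.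
have me : e^-1 <= m by rewrite le_max lexx orbT.
have m0 : 0 < m by exact: lt_le_trans m1.
have K0' : 0 < K by exact: lt_le_trans K0.
exists (K * m ^+ 2); first by rewrite mulr_gt0// exprn_gt0.
move=> n; apply: (@le_trans _ _ (K * m ^+ n.+2)).
  apply: (@le_trans _ _ (K * e^-1 ^+ n.+2)).
    by rewrite exprVn -ler_pdivrMr ?invr_gt0 ?exprn_gt0// invrK.
  by rewrite ler_wpM2l ?(ltW K0')//; apply: lerXn2r; rewrite // nnegrE ?invr_ge0 ltW.
rewrite exprMn ler_pM ?exprn_ge0 ?(ltW m0) ?(ltW K0')//.
  by rewrite exprS ler_peMr ?(ltW K0')// exprn_ege1.
rewrite -exprM; apply: ler_weXn2l => //.
by rewrite mul2n -addnn addnS addSn !ltnS leq_addr.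
Qed.

Lemma evalGcE f z s : series (ps_terms (val (f : Gcset R)) z) @ \oo --> s ->
  evalGc f z = z + s.
Proof.
move=> fs; rewrite /evalGc; congr (_ + _); apply: (@cvgC_unique _ _ _ _ _ fs).
by apply/cvg_ex; exists s.
Qed.

Lemma Gc_growth f : geometric_growth (val (f : Gcset R)).
Proof. by apply: convergent_geometric; exact: set_mem (valP (f : Gcset R)). Qed.

Definition mkGc d (gd : geometric_growth d) : Gc R :=
  (exist (fun d => d \in @convergent_ps R) d (mem_set (geometric_convergent gd)) : Gcset R).

Lemma evalGc_small f : exists2 e : R, 0 < e & forall z, modC z <= e ->
  series (ps_terms (val (f : Gcset R)) z) @ \oo --> evalGc f z - z /\
  modC (evalGc f z) <= 2 * modC z.
Proof.
have [B B0 fB] := Gc_growth f; exists ((2 * B)^-1); first by rewrite invr_gt0 mulr_gt0.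
move=> z zr.
have Bz : B * modC z <= 2^-1.
  by move: zr; rewrite invfM mulrC ler_pdivlMl// mulrC [_^-1 in X in _ -> X]mulrC mulrC.
have [s sP] := ps_term_cvg B0 Bz (modC_ge0 z) fB (lexx _).
have E := evalGcE sP; rewrite E addrAC subrr add0r; split => //.
apply: le_trans (modCD _ _) _; rewrite mulr_natl mulr2n lerD//.
apply: (@le_trans _ _ (2 * (B * modC z ^+ 2))).
  apply: (geo_bound (C := B * modC z ^+ 2) (q := B * modC z) _ _ _ sP).
  - by apply: mulr_ge0; [exact: ltW|rewrite exprn_ge0// modC_ge0].
  - by rewrite Bz mulr_ge0 ?modC_ge0// ltW.
  - by move=> i; apply: eq_term_le => //; exact: ltW.
rewrite expr2 !mulrA ler_piMl ?modC_ge0// -mulrA.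
by apply: (@le_trans _ _ (2 * 2^-1)); [rewrite ler_wpM2l|rewrite divff].
Qed.

(** Identity theorem: by induction the coefficients below n vanish, and then the
    n-th one is bounded by a multiple of x for every small x > 0. *)
Lemma Gc_germ_inj f g :
  (\forall z \near (0 : CC R), evalGc f z = evalGc g z) -> f = g.
Proof.
move=> /near0CP[e1 e10 fg].
have [e2 e20 fP] := evalGc_small f; have [e3 e30 gP] := evalGc_small g.
have [B B0 fB] := Gc_growth f; have [C C0 gC] := Gc_growth g.
pose c n := val (f : Gcset R) n - val (g : Gcset R) n.
have cB n : modC (c n) <= (B + C) ^+ n.+1.
  apply: le_trans (modCB _ _) _; apply: le_trans (lerD (fB n) (gC n)) _.
  elim: n => [|n IH]; first by rewrite !expr1.
  rewrite exprS [C ^+ _]exprS [(B + C) ^+ _]exprS mulrDl lerD// ler_wpM2l ?(ltW B0) ?(ltW C0)//.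
    by apply: lerXn2r; rewrite ?nnegrE ?addr_ge0 ?(ltW B0) ?(ltW C0)// lerDl ltW.
  by apply: lerXn2r; rewrite ?nnegrE ?addr_ge0 ?(ltW B0) ?(ltW C0)// lerDr ltW.
have BC0 : 0 < B + C by rewrite addr_gt0.
pose e := Num.min (Num.min (e1 / 2) (2 * (B + C))^-1) (Num.min e2 e3).
have ep : 0 < e by rewrite !lt_min e20 e30 divr_gt0//= invr_gt0 mulr_gt0.
have e1e : e < e1.
  rewrite gt_min; apply/orP; left; rewrite gt_min; apply/orP; left.
  by rewrite ltr_pdivrMr// ltr_pMr// ltr1n.
have eBC : e <= (2 * (B + C))^-1 by rewrite ge_min; apply/orP; left; rewrite ge_min lexx orbT.
have e2e : e <= e2 by rewrite ge_min; apply/orP; right; rewrite ge_min lexx.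
have e3e : e <= e3 by rewrite ge_min; apply/orP; right; rewrite ge_min lexx orbT.
have c0 z : modC z <= e -> series (ps_terms c z) @ \oo --> (0 : CC R).
  move=> ze; have [Sf _] := fP z (le_trans ze e2e); have [Sg _] := gP z (le_trans ze e3e).
  have -> : series (ps_terms c z) = fun n => series (ps_terms (val (f : Gcset R)) z) n -
      series (ps_terms (val (g : Gcset R)) z) n.
    apply/funext => n; rewrite /series /= -sumrB; apply: eq_bigr => i _.
    by rewrite /ps_terms /c mulrBl.
  have E : evalGc f z - z - (evalGc g z - z) = 0.
    by rewrite (fg z (le_lt_trans ze e1e)) subrr.
  have L : (fun n => series (ps_terms (val (f : Gcset R)) z) n -
      series (ps_terms (val (g : Gcset R)) z) n) @ \oo -->
      (evalGc f z - z - (evalGc g z - z)) by exact: (cvgB Sf Sg).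
  by move: L; rewrite E.
have cz n : c n = 0.
  elim/ltn_ind: n => n IH; apply/modC_eq0/eqP; rewrite eq_le modC_ge0 andbT.
  apply/ler_addgt0Pr => t t0; rewrite add0r.
  have K0 : 0 < 2 * (B + C) ^+ n.+2 by rewrite mulr_gt0// exprn_gt0.
  pose x := Num.min e (t / (2 * (B + C) ^+ n.+2)).
  have x0 : 0 < x by rewrite lt_min ep divr_gt0.
  have xe : x <= e by rewrite ge_min lexx.
  have xE : modC (realC x) = x by rewrite modC_realC gtr0_norm.
  have := c0 (realC x); rewrite xE => /(_ xe) S.
  have Bx : (B + C) * x <= 2^-1.
    apply: (@le_trans _ _ ((B + C) * (2 * (B + C))^-1)).
      by rewrite ler_pM2l// (le_trans xe).
    by rewrite invfM mulrCA divff ?mulr1 ?lexx ?gt_eqF.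
  have Q : 0 <= (B + C) * x <= 2^-1 by rewrite Bx mulr_ge0// ltW.
  have D0 : 0 <= (B + C) * x ^+ 2 by rewrite mulr_ge0 ?exprn_ge0 ?ltW.
  have xx : modC (realC x) <= x by rewrite xE.
  have := geo_tail D0 Q (fun i => eq_term_le i (ltW BC0) cB xx) n.+1 S.
  rewrite sub0r modCN /series /= big_nat_recr //= big1_seq => [|i]; last first.
    by rewrite mem_index_iota /= => /IH ->; rewrite /ps_terms mul0r.
  rewrite add0r /ps_terms modCM modCX xE exprMn.
  have -> : 2 * ((B + C) * x ^+ 2) * ((B + C) ^+ n.+1 * x ^+ n.+1) =
      2 * (B + C) ^+ n.+2 * x * x ^+ n.+2 by rewrite !exprS; ring.
  rewrite ler_pM2r ?exprn_gt0// => /le_trans; apply.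
  by rewrite mulrC -ler_pdivlMr// ge_min lexx orbT.
apply: val_inj; apply/funext => n; apply/eqP; rewrite -subr_eq0; exact/eqP/cz.
Qed.

End PowerSeries.

(** * The first return map *)

Section FirstReturn.
Variable R : realType.
Local Notation mu := (@lebesgue_measure R).
Local Notation tpi := (twopi R).
Implicit Types (a b : X R) (r : CC R) (v h : R -> CC R).

Lemma return_growth a : geometric_growth (fun n => flow_coef a n.+1 0).
Proof.
have [B B0 [_ phiB]] := flow_coef_bound a; exists B => // n; apply: phiB.
by rewrite bound_itvE ltW// twopi_gt0.
Qed.

Definition return_series a : Gc R := mkGc (return_growth a).

(** For small r all solutions have the same value at time 2 pi, so the choice made
    in [ode_flow] does not affect the return map. *)
Lemma ode_near0 a : exists2 e : R, 0 < e & forall r, modC r < e ->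
  (exists v, ode_solution a r v) /\
  forall v, ode_solution a r v -> v tpi = evalGc (return_series a) r.
Proof.
have [B B0 [aB phiB]] := flow_coef_bound a; have t0 := twopi_gt0 R.
pose rho := B^-1 / (8 * (1 + tpi)).
have t1 : 0 < 1 + tpi by rewrite addr_gt0.
have rho0 : 0 < rho by rewrite divr_gt0 ?invr_gt0// mulr_gt0.
have BE : B * rho = (8 * (1 + tpi))^-1 by rewrite /rho mulrA divff ?mul1r// gt_eqF.
have Brho : B * rho <= 8^-1.
  by rewrite BE lef_pV2 ?posrE ?mulr_gt0// ler_peMr// lerDl ltW.
have Brhot : 8 * tpi * (B * rho) <= 1.
  by rewrite BE ler_pdivrMr ?mulr_gt0// mul1r ler_pM2l// lerDr.
exists (rho / 2); first by rewrite divr_gt0.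
move=> r /ltW rr; split; first exact: (ode_exists B0 rho0 aB Brho Brhot rr).
move=> v av; have vr := ode_small B0 rho0 aB Brho Brhot rr av.
have S := ode_expansion B0 rho0 aB phiB Brho av vr.
by rewrite (evalGcE (f := return_series a) S) addrC subrK.
Qed.

Theorem first_return_series a : first_return a = return_series a.
Proof.
have [e e0 H] := ode_near0 a.
have flow : \forall r \near (0 : CC R), ode_flow tpi r a = evalGc (return_series a) r.
  apply/near0CP; exists e => // r re; have [[v av] E] := H r re.
  rewrite /ode_flow; apply: E.
  exact: (xgetI (P := ode_solution a r) (cst 0) av).
have := xgetI (P := [set f : Gc R | \forall r \near (0 : CC R),
  ode_flow tpi r a = evalGc f r]) (oneGc R) flow.
rewrite -/(first_return a) /= => flow'.
by apply: Gc_germ_inj; apply: filterS2 flow flow' => r -> ->.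
Qed.

Lemma first_return_coef a n : coefGc n (first_return a : Gcset R) = flow_coef a n.+1 0.
Proof. by rewrite first_return_series. Qed.

(** The first return map is defined on classes because its coefficients are linear
    combinations of iterated integrals. *)
Lemma first_return_basic_int a b :
  (fun w => basic_int w a) = (fun w => basic_int w b) -> first_return a = first_return b.
Proof.
move=> ab; apply: val_inj; apply/funext => n.
rewrite -[LHS]/(coefGc n _) -[RHS]/(coefGc n _) !first_return_coef /flow_coef.
apply: eq_bigr => w _; congr (_ * _).
exact: (congr1 (fun f => f w) ab).
Qed.

(** Both halves are solutions after doubling the time, and they match at pi. *)
Lemma ode_concat a b r v u : ode_solution a r v -> ode_solution b (v tpi) u ->
  ode_solution (concatX a b) r
    (fun t => if t <= pi then v (2 * t) else u (2 * t - tpi)).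
Proof.
move=> /ode_primitive[v0 [h [Pv hv]]] /ode_primitive[u0 [k [Pu ku]]].
have p0 := pi_gt0 R; have pt := pi_lt_twopi R.
set w := (X in ode_solution _ _ X).
pose g t : CC R := if t <= pi then 2 * h (2 * t) else 2 * k (2 * t - tpi).
have Pl : primitive 0 pi w g.
  apply: (primitive_eq_in _ _ (@primitive_affine _ 0 tpi 0 pi 2 0 v h _ _ _ Pv)) => //.
  - by move=> x; rewrite in_itv /= => /andP[_ xp]; rewrite /w xp addr0.
  - apply: aeW => x; rewrite in_itv /= => /andP[_ xp].
    by rewrite /g (ltW xp) addr0 realC2.
  - by move=> x; rewrite !in_itv /= /twopi; move: p0; lra.
  - by move=> x; rewrite !in_itv /= /twopi; move: p0; lra.
have Pr : primitive pi tpi w g.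
  apply: (primitive_eq_in _ _ (@primitive_affine _ 0 tpi pi tpi 2 (- tpi) u k _ _ _ Pu)) => //.
  - move=> x; rewrite in_itv /= le_eqVlt => /andP[/predU1P[<-|px] _]; rewrite /w.
      by rewrite lexx /twopi subrr u0.
    by rewrite leNgt px.
  - apply: aeW => x; rewrite in_itv /= => /andP[px _].
    by rewrite /g leNgt px realC2.
  - by move=> x; rewrite !in_itv /= /twopi; move: p0; lra.
  - by move=> x; rewrite !in_itv /= /twopi; move: p0; lra.
apply: (primitive_ode (h := g)).
- by rewrite /w (ltW p0) mulr0.
- by apply: primitive_glue Pl Pr; exact: ltW.
have n2 : (2 : R) != 0 by [].
apply: (aeS3 _ (ae_neq pi) (ae_affine 0 n2 hv) (ae_affine (- tpi) n2 ku)) => x xpi hx kx.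
rewrite in_itv /= => /andP[x0 xt].
have S (c d : nat -> CC R) (s : CC R) : (forall n, d n = 2 * c n) ->
    series c @ \oo --> s -> series d @ \oo --> 2 * s.
  move=> cd cs; rewrite (_ : series d = fun n => 2 * series c n).
    exact: (cvgM (cvg_cst (2 : CC R)) cs).
  by apply/funext => n; rewrite /series /= big_distrr; apply: eq_bigr => i _; exact: cd.
move: xpi; rewrite neq_lt => /orP[xp|px]; rewrite /g /w.
  rewrite (ltW xp); apply: (S (fun n => a n (2 * x) * v (2 * x) ^+ n.+2)).
    by move=> n; rewrite [concat_fun _ _ _ _](concat_left a b n x0 (ltW xp)) mulrA.
  move: hx; rewrite addr0; apply; rewrite in_itv /= mulr_gt0//=.
  by rewrite /twopi ltr_pM2l.
rewrite leNgt px /=; apply: (S (fun n => b n (2 * x - tpi) * u (2 * x - tpi) ^+ n.+2)).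
  by move=> n; rewrite [concat_fun _ _ _ _](concat_right a b n px (ltW xt)) mulrA.
by apply: kx; rewrite in_itv /=; move: px xt; rewrite /twopi; lra.
Qed.

(** The glued solution shows that the composite germ is represented by
    [first_return (concatX a b)], and by the identity theorem this is the series
    that [mulGc] selects. *)
Theorem first_return_concat a b :
  mulGc (first_return a) (first_return b) = first_return (concatX a b).
Proof.
have germ : \forall z \near (0 : CC R), evalGc (first_return (concatX a b)) z =
    evalGc (first_return b) (evalGc (first_return a) z).
  rewrite !first_return_series.
  have [ea ea0 Ha] := ode_near0 a; have [eb eb0 Hb] := ode_near0 b.
  have [eab eab0 Hab] := ode_near0 (concatX a b).
  have [es es0 Hs] := evalGc_small (return_series a).
  apply/near0CP; exists (Num.min (Num.min ea eab) (Num.min es (eb / 2))).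
    by rewrite !lt_min ea0 eab0 es0 divr_gt0.
  move=> z; rewrite !lt_min => /andP[/andP[za zab] /andP[zs zb]].
  have [[v av] Ev] := Ha z za.
  have vb : modC (v tpi) < eb.
    rewrite (Ev v av); apply: le_lt_trans (Hs z (ltW zs)).2 _.
    by rewrite mulrC -ltr_pdivlMr.
  have [[u bu] Eu] := Hb _ vb.
  rewrite -(Ev v av) -(Eu u bu) -((Hab z zab).2 _ (ode_concat av bu)).
  by rewrite leNgt pi_lt_twopi /= mulr_natl mulr2n addrK.
have := xgetI (P := [set h : Gc R | \forall z \near (0 : CC R),
  evalGc h z = evalGc (first_return b) (evalGc (first_return a) z)]) (oneGc R) germ.
rewrite -/(mulGc _ _) /= => germ'.
by apply: Gc_germ_inj; apply: filterS2 germ germ' => r -> ->.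
Qed.

End FirstReturn.

(** * Initial topologies *)

Section WeakestTopology.
Variables (T : choiceType) (U : topologicalType) (f : nat -> T -> U).

Lemma weakest_continuous n : continuous (f n : weakest_topology f -> U).
Proof.
move=> x A fA.
have /cvg_sup/(_ n) : nbhs (x : weakest_topology f) --> (x : weakest_topology f) by apply: cvg_id.
apply; exact: (@initial_continuous T U (f n) x A fA).
Qed.

Lemma continuous_weakest (S : topologicalType) (h : S -> weakest_topology f) :
  (forall n, continuous (f n \o h : S -> U)) -> continuous h.
Proof.
move=> H x; apply/cvg_sup => n A [B [[C oC <-] Bx] BA].
have nC : nbhs (f n (h x)) C by exact: open_nbhs_nbhs.
have N : nbhs x ((f n \o h) @^-1` C) := H n x C nC.
suff : nbhs x (h @^-1` A) by [].
by apply: filterS N => y Cy; exact: BA.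
Qed.

End WeakestTopology.

(** * Paths with a prescribed first return map *)

Section Interpolation.
Variable R : realType.
Local Notation mu := (@lebesgue_measure R).
Local Notation tpi := (twopi R).
Implicit Types (d : nat -> CC R) (t : CC R).

(** The coefficients in r of (f(r) - r) / (2 pi Phi_r), where
    Phi = r + t (f(r) - r) and f - r has the coefficients d; that is, the vector
    field forced by the transport equation when t = 1 - s / 2 pi.  The argument k
    bounds the depth of the recursion. *)
Fixpoint field_coef_rec d t k n : CC R :=
  if k is k'.+1 then
    realC tpi^-1 * d n -
    \sum_(i < n) (n - i).+1%:R * field_coef_rec d t k' i * (t * d (n - i).-1%N)
  else 0.

Definition field_coef d t n := field_coef_rec d t n.+1 n.

Lemma field_coef_rec_enough d t k n : (n < k)%N -> field_coef_rec d t k n = field_coef d t n.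
Proof.
rewrite /field_coef; elim/ltn_ind: n k => n IH [//|k] nk /=; congr (_ - _).
apply: eq_bigr => i _; congr (_ * _ * _).
by rewrite [LHS]IH ?[RHS]IH // (leq_trans (ltn_ord i)).
Qed.

Lemma field_coefE d t n : field_coef d t n =
  realC tpi^-1 * d n -
  \sum_(i < n) (n - i).+1%:R * field_coef d t i * (t * d (n - i).-1%N).
Proof.
rewrite {1}/field_coef /=; congr (_ - _); apply: eq_bigr => i _.
by rewrite field_coef_rec_enough.
Qed.

Lemma twopi_inv_le1 : tpi^-1 <= 1.
Proof.
rewrite invf_le1 ?twopi_gt0// /twopi.
have := pi_ge2 R; lra.
Qed.

(** The term d n takes one half of the bound.  The sum takes the other half: the
    factor 8^(n-i) compensates n - i + 1 <= 2^(n-i), the factor 1/2 and the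
    summation over i. *)
Lemma field_coef_le d t (l : R) : 0 < l -> modC t <= 1 ->
  (forall n, modC (d n) <= l ^+ n.+1) ->
  forall n, modC (field_coef d t n) <= (8 * l) ^+ n.+1.
Proof.
move=> l0 t1 dl; elim/ltn_ind => n IH.
have K0 : 0 <= 8 * l by rewrite mulr_ge0// ltW.
have KK : 0 <= (8 * l) ^+ n.+1 by rewrite exprn_ge0.
rewrite field_coefE; apply: le_trans (modCB _ _) _.
rewrite [leRHS]splitr; apply: lerD.
  have p0 : 0 <= tpi^-1 by rewrite invr_ge0 ltW// twopi_gt0.
  rewrite modCM modC_realC (ger0_norm p0).
  apply: (@le_trans _ _ (1 * l ^+ n.+1)).
    by apply: ler_pM; rewrite ?modC_ge0 ?twopi_inv_le1.
  rewrite mul1r ler_pdivlMr// exprMn mulrC ler_wpM2r ?exprn_ge0 ?(ltW l0)//.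
  rewrite exprS -[leLHS]mulr1; apply: ler_pM; rewrite ?ler_nat//.
  by rewrite exprn_ege1// ler1n.
apply: le_trans (modC_sum _ _ _) _.
apply: (@le_trans _ _ (\sum_(i < n) (8 * l) ^+ n.+1 / 2 * 2^-1 ^+ (n - i))).
  apply: ler_sum => i _; have iN := ltn_ord i.
  rewrite !modCM modC_nat.
  apply: (@le_trans _ _ ((n - i).+1%:R * (8 * l) ^+ i.+1 * (1 * l ^+ (n - i)))).
    apply: ler_pM; rewrite ?mulr_ge0 ?modC_ge0//.
      by apply: ler_wpM2l => //; exact: IH.
    apply: ler_pM; rewrite ?modC_ge0//.
    by rewrite -[X in l ^+ X]prednK ?subn_gt0//; exact: dl.
  have -> : (8 * l) ^+ n.+1 = (8 * l) ^+ i.+1 * (8 ^+ (n - i) * l ^+ (n - i)).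
    by rewrite -exprMn -exprD addSn subnKC// ltnW.
  set j := (n - i)%N; have j0 : (0 < j)%N by rewrite subn_gt0.
  have -> : (8 * l) ^+ i.+1 * (8 ^+ j * l ^+ j) / 2 * 2^-1 ^+ j =
      (2 ^+ j * (2 ^+ j / 2)) * (8 * l) ^+ i.+1 * (1 * l ^+ j).
    have -> : 8 ^+ j = 2 ^+ j * 2 ^+ j * 2 ^+ j :> R.
      by rewrite -!exprMn; congr (_ ^+ _); rewrite -!natrM.
    by rewrite exprVn; field; rewrite expf_neq0.
  rewrite ler_wpM2r ?mul1r ?exprn_ge0 ?(ltW l0)// ler_wpM2r ?exprn_ge0//.
  rewrite -[leLHS]mulr1; apply: ler_pM => //.
    by rewrite -natrX ler_nat ltn_expl.
  by rewrite ler_pdivlMr// mul1r -{1}[2]expr1 ler_weXn2l// ler1n.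
rewrite -big_distrr /= ler_piMr ?divr_ge0//.
rewrite (reindex_inj rev_ord_inj) /=.
under eq_bigr => i _ do rewrite subKn//.
by rewrite geo_half_sum gerBl exprn_ge0// invr_ge0.
Qed.

(** The fraction of the period that remains after time s. *)
Definition remaining (s : R) : CC R := realC (1 - s / tpi).

Definition path_fun d : nat -> R -> CC R := fun n s => field_coef d (remaining (circ s)) n.

Lemma circ_itv (s : R) : 0 < circ s <= tpi.
Proof.
have t0 := twopi_gt0 R; rewrite /circ.
have /andP[c1 c2] := real_ceil_itv (num_real (s / tpi)).
set m := (_ - 1)%:~R in c1 *.
have -> : s - tpi * m = tpi * (s / tpi - m) by field; rewrite gt_eqF.
rewrite pmulr_rgt0// subr_gt0 c1 /= ler_piMr ?(ltW t0)// lerBlDl.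
by move: c2; rewrite /m intrB subrK.
Qed.

Lemma modC_remaining s : 0 <= s <= tpi -> modC (remaining s) <= 1.
Proof.
move=> /andP[s0 st]; have t0 := twopi_gt0 R.
rewrite modC_realC ger0_norm; first by rewrite gerBl divr_ge0// ltW.
by rewrite subr_ge0 ler_pdivrMr// mul1r.
Qed.

Lemma measC_path_fun d n : measC setT (path_fun d n).
Proof.
have mt : measC setT (fun s : R => remaining (circ s)).
  split; last exact: measurable_cst.
  apply: measurable_funB => //; apply: measurable_funM => //.
  exact: measurable_circ.
elim/ltn_ind: n => n IH.
have mN (f : R -> CC R) : measC setT f -> measC setT (fun s => - f s).
  move=> mf; under [X in measC _ X]funext do rewrite -mulN1r.
  exact: measCM (measC_cst _ _) mf.
rewrite (_ : path_fun d n = fun s => realC tpi^-1 * d n - \sum_(0 <= i < n)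
    (n - i).+1%:R * path_fun d i s * (remaining (circ s) * d (n - i).-1%N)).
  apply: measCD; first exact: measC_cst.
  apply: mN; apply: (measC_sum (F := fun i s => (n - i).+1%:R *
    path_fun d i s * (remaining (circ s) * d (n - i).-1%N))) => i iN.
  apply: measCM; last by apply: measCM mt (measC_cst _ _).
  by apply: measCM (measC_cst _ _) (IH i iN).
by apply/funext => s; rewrite /path_fun field_coefE big_mkord.
Qed.

Lemma inX_path d : geometric_growth d -> inX (path_fun d).
Proof.
move=> [l l0 dl]; split; last first.
  exists (8 * l); first by rewrite mulr_gt0.
  move=> n; apply/ess_supP; apply: aeW => s; rewrite lee_fin.
  apply: field_coef_le => //; apply: modC_remaining.
  by have /andP[/ltW -> ->] := circ_itv s.
move=> n; split; first by move=> t; rewrite /path_fun circD.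
  by case: (measC_path_fun d n).
by case: (measC_path_fun d n).
Qed.

Definition path_of d (gd : geometric_growth d) : X R := MkX (inX_path gd).

Lemma remaining_primitive p q :
  primitive p q remaining (fun=> - realC tpi^-1).
Proof.
have := primitiveD (primitive_cst p q (realC 1)) (primitive_id p q (- tpi^-1)).
apply: primitive_eq_in => [x _|].
  by rewrite -realCD /remaining; congr realC; ring.
by apply: aeW => x _; rewrite add0r realCN.
Qed.

Lemma remaining_twopi : remaining tpi = 0.
Proof. by rewrite /remaining divff ?subrr// gt_eqF// twopi_gt0. Qed.

Lemma remaining0 : remaining 0 = 1.
Proof. by rewrite /remaining mul0r subr0. Qed.

(** Both sides solve the transport equation with the value 0 at time 2 pi. *)
Lemma flow_coef_path d (gd : geometric_growth d) n s : s \in `[0, tpi] ->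
  flow_coef (path_of gd) n.+1 s = remaining s * d n.
Proof.
have t0 := ltW (twopi_gt0 R).
elim/ltn_ind: n s => n IH s sp.
have Pe := primitiveM (remaining_primitive 0 tpi) (primitive_cst 0 tpi (d n)).
apply: (primitive_unique (x0 := tpi) _ (flow_coef_primitive (path_of gd) n) Pe _ _ sp).
- by rewrite bound_itvE.
- apply: aeW => x xp; have xp' := subset_itv_oo_cc xp.
  move: xp; rewrite in_itv /= => /andP[x0 xt].
  rewrite mulr0 addr0 mulNr; congr (- _).
  have E i : path_fun d i x = field_coef d (remaining x) i.
    by rewrite /path_fun circ_id// ltW.
  rewrite big_ord_recr /= subnn (flow_coef0 (path_of gd)) mul1r mulr1 E field_coefE addrC.
  rewrite -addrA -[RHS]addr0; congr (_ + _); rewrite addrC; apply/eqP.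
  rewrite subr_eq0; apply/eqP; apply: eq_bigr => i _; rewrite E.
  have iN : (0 < n - i)%N by rewrite subn_gt0.
  rewrite -[in flow_coef _ _ _](prednK iN) [flow_coef _ _ _](IH _ _ x xp')//.
  by rewrite prednK// leq_subr.
- by rewrite flow_coef_twopi remaining_twopi mul0r.
Qed.

Theorem first_return_path d (gd : geometric_growth d) n :
  coefGc n (first_return (path_of gd) : Gcset R) = d n.
Proof.
rewrite first_return_coef flow_coef_path ?remaining0 ?mul1r// bound_itvE.
by rewrite ltW// twopi_gt0.
Qed.

Definition section_path (f : Gc R) : X R := path_of (Gc_growth f).

Lemma first_return_section f : first_return (section_path f) = f.
Proof. by apply: val_inj; apply/funext => n; exact: first_return_path. Qed.

End Interpolation.

(** * Continuous dependence of the iterated integrals *)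

Section PolynomialFamilies.
Variable R : realType.
Local Notation mu := (@lebesgue_measure R).
Local Notation tpi := (twopi R).
Implicit Types (F G : Gc R -> R -> CC R) (f g : Gc R).

(** Polynomials in [remaining s] with coefficients continuous on [Gc R], as
    functions on the period: a class that contains the coefficients of the
    interpolating field and is stable under the operations that form iterated
    integrals. *)
Inductive poly_family : (Gc R -> R -> CC R) -> Prop :=
| PolyMono (q : Gc R -> CC R) k : continuous q ->
    poly_family (fun f s => q f * remaining s ^+ k)
| PolyAdd F G : poly_family F -> poly_family G ->
    poly_family (fun f s => F f s + G f s)
| PolyEq F G : poly_family F ->
    (forall f s, s \in `[0, tpi] -> F f s = G f s) -> poly_family G.

Lemma continuousCD (S : topologicalType) (p q : S -> CC R) :
  continuous p -> continuous q -> continuous (fun x => p x + q x).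
Proof. by move=> cp cq x; exact: (cvgD (cp x) (cq x)). Qed.

Lemma continuousCM (S : topologicalType) (p q : S -> CC R) :
  continuous p -> continuous q -> continuous (fun x => p x * q x).
Proof. by move=> cp cq x; exact: (cvgM (cp x) (cq x)). Qed.

Lemma continuousC_cst (S : topologicalType) (c : CC R) : continuous (fun _ : S => c).
Proof. by move=> x; exact: cvg_cst. Qed.

Lemma continuousC_sum (S : topologicalType) (I : Type) (r : seq I) (p : I -> S -> CC R) :
  (forall i, continuous (p i)) -> continuous (fun x => \sum_(i <- r) p i x).
Proof.
move=> cp; elim: r => [|i r IH].
  rewrite (_ : (fun x => _) = fun=> 0); first exact: continuousC_cst.
  by apply/funext => x; rewrite big_nil.
rewrite (_ : (fun x => _) = fun x => p i x + \sum_(i <- r) p i x).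
  exact: (continuousCD (cp i) IH).
by apply/funext => x; rewrite big_cons.
Qed.

Lemma continuous_coefGc n : continuous (fun f : Gc R => coefGc n (f : Gcset R)).
Proof. exact: (@weakest_continuous _ _ (@coefGc R) n). Qed.

Lemma poly_family_cst (q : Gc R -> CC R) : continuous q -> poly_family (fun f _ => q f).
Proof. by move=> cq; apply: PolyEq (PolyMono 0 cq) _ => f s _; rewrite mulr1. Qed.

Lemma poly_familyM F G : poly_family F -> poly_family G ->
  poly_family (fun f s => F f s * G f s).
Proof.
move=> pF pG; elim: pF => {F} [q k cq|F1 F2 _ IH1 _ IH2|F1 F2 _ IH FE].
- elim: pG => {G} [q' k' cq'|G1 G2 _ IH1 _ IH2|G1 G2 _ IH GE].
  + apply: PolyEq (PolyMono (k + k') (continuousCM cq cq')) _ => f s _.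
    by rewrite exprD; ring.
  + by apply: PolyEq (PolyAdd IH1 IH2) _ => f s _; rewrite mulrDr.
  + by apply: PolyEq IH _ => f s sp; rewrite GE.
- by apply: PolyEq (PolyAdd IH1 IH2) _ => f s _; rewrite mulrDl.
- by apply: PolyEq IH _ => f s sp; rewrite FE.
Qed.

Lemma poly_family_sum (I : Type) (r : seq I) (F : I -> Gc R -> R -> CC R) :
  (forall i, poly_family (F i)) -> poly_family (fun f s => \sum_(i <- r) F i f s).
Proof.
move=> pF; elim: r => [|i r IH].
  apply: (PolyEq (poly_family_cst (@continuousC_cst (Gc R) 0))) => f s _.
  by rewrite big_nil.
by apply: PolyEq (PolyAdd (pF i) IH) _ => f s _; rewrite big_cons.
Qed.

Lemma poly_family_int F : poly_family F -> exists2 G, poly_family G &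
  forall f, primitive 0 tpi (G f) (fun s => - F f s) /\ G f tpi = 0.
Proof.
have t0 := twopi_gt0 R.
elim=> {F} [q k cq|F1 F2 _ [G1 p1 H1] _ [G2 p2 H2]|F1 F2 _ [G pG H] FE].
- pose c : CC R := realC tpi / k.+1%:R.
  exists (fun f s => (c * q f) * remaining s ^+ k.+1).
    exact: (PolyMono k.+1 (@continuousCM (Gc R) (fun=> c) q (@continuousC_cst (Gc R) c) cq)).
  move=> f; split; last by rewrite remaining_twopi expr0n mulr0.
  have := primitiveZ (c * q f) (primitiveX k (remaining_primitive 0 tpi)).
  congr primitive; apply/funext => s.
  have tt : realC tpi * realC tpi^-1 = 1 :> CC R by rewrite -realCM divff// gt_eqF.
  have kk : c * k.+1%:R = realC tpi by rewrite /c divfK// pnatr_eq0.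
  rewrite !mulrN; congr (- _).
  transitivity (c * k.+1%:R * realC tpi^-1 * (q f * remaining s ^+ k)); first by ring.
  by rewrite kk tt mul1r.
- exists (fun f s => G1 f s + G2 f s); first exact: PolyAdd.
  move=> f; have [P1 e1] := H1 f; have [P2 e2] := H2 f; split; last by rewrite e1 e2 addr0.
  have := primitiveD P1 P2; congr primitive.
  by apply/funext => s; rewrite opprD.
- exists G => // f; have [P e] := H f; split => //.
  apply: primitive_eq_in P => //; apply: aeW => s sp.
  by rewrite FE//; exact: subset_itv_oo_cc sp.
Qed.

Lemma poly_family_at0 F : poly_family F -> continuous (F ^~ 0).
Proof.
elim=> {F} [q k cq|F1 F2 _ IH1 _ IH2|F1 F2 _ IH FE].
- exact: (@continuousCM (Gc R) q (fun=> remaining 0 ^+ k) cq (@continuousC_cst (Gc R) _)).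
- exact: (continuousCD IH1 IH2).
- rewrite (_ : F2 ^~ 0 = F1 ^~ 0)//; apply/funext => f; rewrite FE//.
  by rewrite bound_itvE ltW// twopi_gt0.
Qed.

Lemma poly_family_field n :
  poly_family (fun f s => field_coef (val (f : Gcset R)) (remaining s) n).
Proof.
have pd k : poly_family (fun f _ => val (f : Gcset R) k).
  by apply: poly_family_cst; exact: continuous_coefGc.
have pc (c : CC R) : poly_family (fun _ _ => c).
  by apply: poly_family_cst; exact: continuousC_cst.
have pe : poly_family (fun _ s => remaining s).
  apply: (PolyEq (PolyMono 1 (@continuousC_cst (Gc R) 1))) => f s _.
  by rewrite mul1r.
suff H k m : poly_family (fun f s => field_coef_rec (val (f : Gcset R)) (remaining s) k m).
  exact: H.
elim: k m => [|k IH] m; first exact: pc.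
have S : poly_family (fun f s => \sum_(i < m) (- (m - i).+1%:R) *
    field_coef_rec (val (f : Gcset R)) (remaining s) k i *
    (remaining s * val (f : Gcset R) (m - i).-1%N)).
  apply: poly_family_sum => i; apply: poly_familyM; last exact: poly_familyM.
  exact: poly_familyM.
apply: PolyEq (PolyAdd (poly_familyM (pc (realC tpi^-1)) (pd m)) S) _ => f s _ /=.
by congr (_ + _); rewrite -sumrN; apply: eq_bigr => i _; rewrite !mulNr.
Qed.

Lemma poly_family_iter_int w :
  poly_family (fun f s => iter_int (section_path f) w s).
Proof.
elim: w => [|i w IH]; first by apply: poly_family_cst; exact: continuousC_cst.
have [G pG H] := poly_family_int (poly_familyM (poly_family_field i) IH).
apply: PolyEq pG _ => f; have [P e] := H f.
apply: (primitive_unique (x0 := tpi) _ P (iter_int_primitive (section_path f) i w)).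
- by rewrite bound_itvE ltW// twopi_gt0.
- apply: aeW => s; rewrite in_itv /= => /andP[s0 st].
  by rewrite /path_fun circ_id// ltW.
- by rewrite iter_int_twopi e.
Qed.

Lemma continuous_basic_int w : continuous (fun f => basic_int w (section_path f)).
Proof. exact: (poly_family_at0 (poly_family_iter_int w)). Qed.

(** In Chen's formula for the trivial path a * a^-1 the term that contains the
    integral of a^-1 over the whole word has coefficient 1; the other terms
    involve shorter words. *)
Lemma continuous_basic_int_inv w :
  continuous (fun f => basic_int w (invX (section_path f))).
Proof.
have [n] := ubnP (size w); elim: n w => // n IH [|i w] /= wn.
  exact: continuousC_cst.
rewrite (_ : (fun f => _) = fun f => - (\sum_(j < (size w).+1)
    basic_int (i :: take j w) (section_path f) *
    basic_int (drop j w) (invX (section_path f)))).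
  have cs : continuous (fun f => \sum_(j < (size w).+1)
      basic_int (i :: take j w) (section_path f) *
      basic_int (drop j w) (invX (section_path f))).
    apply: continuousC_sum => j; apply: continuousCM; first exact: continuous_basic_int.
    apply: IH; rewrite size_drop; apply: leq_ltn_trans (leq_subr j (size w)) _.
    exact: wn.
  by move=> f; exact: (cvgN (cs f)).
apply/funext => f; apply/eqP; rewrite -addr_eq0; apply/eqP.
have E := basic_int_concat_inv (section_path f); rewrite basic_int_concat in E.
have := congr1 (fun I => I (i :: w)) E; rewrite /chen_unit /= chen_cons => E2.
by rewrite -[RHS]E2 [X in X * _](_ : _ = 1) ?mul1r.
Qed.

Lemma continuous_return_coef (S : topologicalType) (a : S -> X R) n :
  (forall w, continuous (fun x => basic_int w (a x))) ->
  continuous (fun x => coefGc n (first_return (a x) : Gcset R)).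
Proof.
move=> H; rewrite (_ : (fun x => _) = fun x => \sum_(w <- words n.+1)
    (word_coef w)%:R * basic_int w (a x)).
  apply: continuousC_sum => w; apply: continuousCM; last exact: H.
  exact: continuousC_cst.
by apply/funext => x; rewrite first_return_coef.
Qed.

End PolynomialFamilies.

(** * The quotient group *)

Section Quotient.
Variable R : realType.
Implicit Types (A B C : GX R) (a b : X R) (p q : QX R).

Lemma Phat_toG a : Phat (toG a) = first_return a.
Proof. exact/first_return_basic_int/basic_int_rep. Qed.

Lemma Phat_mulG A B : Phat (mulG A B) = mulGc (Phat A) (Phat B).
Proof. by rewrite Phat_toG -first_return_concat. Qed.

Lemma first_return_zero : first_return (zeroX R) = oneGc R.
Proof.
apply: val_inj; apply/funext => n; rewrite -[LHS]/(coefGc n _) first_return_coef.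
rewrite /flow_coef big_seq big1// => w /weight_words ww.
rewrite -[iter_int _ _ _]/((fun w => basic_int w (zeroX R)) w) basic_int_zero.
by case: w ww => // i w _; rewrite /chen_unit mulr0.
Qed.

Lemma first_return_concat_inv a : first_return (concatX a (invX a)) = oneGc R.
Proof.
rewrite -first_return_zero; apply: first_return_basic_int.
by rewrite basic_int_concat_inv basic_int_zero.
Qed.

Lemma first_return_inv_concat a : first_return (concatX (invX a) a) = oneGc R.
Proof.
rewrite -first_return_zero; apply: first_return_basic_int.
by rewrite basic_int_inv_concat basic_int_zero.
Qed.

Lemma mulGcA (f g h : Gc R) : mulGc f (mulGc g h) = mulGc (mulGc f g) h.
Proof.
rewrite -(first_return_section f) -(first_return_section g) -(first_return_section h).
rewrite !first_return_concat; apply: first_return_basic_int.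
by rewrite !basic_int_concat chenA.
Qed.

Lemma mul1Gc (f : Gc R) : mulGc (oneGc R) f = f.
Proof.
rewrite -(first_return_section f) -first_return_zero first_return_concat.
by apply: first_return_basic_int; rewrite basic_int_concat basic_int_zero chen1f.
Qed.

Lemma mulGc1 (f : Gc R) : mulGc f (oneGc R) = f.
Proof.
rewrite -(first_return_section f) -first_return_zero first_return_concat.
by apply: first_return_basic_int; rewrite basic_int_concat basic_int_zero chenf1.
Qed.

(** If A and C have the same image, then A^-1 C lies in the kernel and carries A
    to C. *)
Lemma cosetE A : coset A = [set C | Phat C = Phat A].
Proof.
apply/seteqP; split=> C.
  by move=> [K /= K1 <-]; rewrite Phat_mulG K1 mulGc1.
move=> /= CA; exists (toG (concatX (invX (class_rep A)) (class_rep C))).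
  rewrite /kerP /= Phat_toG -first_return_concat -[first_return (class_rep C)]/(Phat C) CA.
  by rewrite first_return_concat first_return_inv_concat.
rewrite -[RHS]toG_rep; apply/toG_basic_int.
rewrite basic_int_concat basic_int_rep basic_int_concat chenA -basic_int_concat.
by rewrite basic_int_concat_inv chen1f.
Qed.

Lemma reprQ_piQ A : coset (reprQ (piQ A)) = coset A.
Proof. by rewrite /reprQ /class_rep; case: cid2. Qed.

Lemma piQ_reprQ q : piQ (reprQ q) = q.
Proof. by apply: val_inj; rewrite /reprQ /class_rep /=; case: cid2. Qed.

Definition Pbar q : Gc R := Phat (reprQ q).

Lemma Pbar_piQ A : Pbar (piQ A) = Phat A.
Proof.
have : coset (reprQ (piQ A)) (reprQ (piQ A)) by rewrite cosetE.
by rewrite reprQ_piQ cosetE.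
Qed.

Lemma Pbar_inj : injective Pbar.
Proof.
move=> p q pq; rewrite -(piQ_reprQ p) -(piQ_reprQ q); apply: val_inj => /=.
by rewrite !cosetE -/(Pbar p) pq.
Qed.

Lemma Pbar_mul p q : Pbar (mulQ p q) = mulGc (Pbar p) (Pbar q).
Proof. by rewrite Pbar_piQ Phat_mulG. Qed.

Lemma Pbar_one : Pbar (oneQ R) = oneGc R.
Proof. by rewrite Pbar_piQ Phat_toG first_return_zero. Qed.

Definition Pbar_inv (f : Gc R) : QX R := piQ (toG (section_path f)).

Lemma Pbar_invK : cancel Pbar_inv Pbar.
Proof. by move=> f; rewrite Pbar_piQ Phat_toG first_return_section. Qed.

Lemma PbarK : cancel Pbar Pbar_inv.
Proof. by move=> q; apply: Pbar_inj; rewrite Pbar_invK. Qed.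

Lemma Pbar_invQ q : Pbar (invQ q) = first_return (invX (class_rep (reprQ q))).
Proof. by rewrite Pbar_piQ Phat_toG. Qed.

Lemma Pbar_mulV q : mulGc (Pbar q) (Pbar (invQ q)) = oneGc R.
Proof. by rewrite Pbar_invQ first_return_concat first_return_concat_inv. Qed.

Lemma Pbar_mulVl q : mulGc (Pbar (invQ q)) (Pbar q) = oneGc R.
Proof. by rewrite Pbar_invQ first_return_concat first_return_inv_concat. Qed.

Lemma Pbar_invQ_section q : Pbar (invQ q) = first_return (invX (section_path (Pbar q))).
Proof.
have H : mulGc (Pbar q) (first_return (invX (section_path (Pbar q)))) = oneGc R.
  rewrite -[X in mulGc X _](first_return_section (Pbar q)).
  by rewrite first_return_concat first_return_concat_inv.
by rewrite -[RHS]mul1Gc -(Pbar_mulVl q) -mulGcA H mulGc1.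
Qed.

Lemma continuous_Pbar : continuous Pbar.
Proof.
apply: continuous_weakest => n; exact: (@weakest_continuous _ _ (@cbar R) n).
Qed.

(** The topology of [QX R] is the one induced by [Pbar]. *)
Lemma continuous_into_QX (S : topologicalType) (h : S -> QX R) :
  continuous (Pbar \o h) -> continuous h.
Proof.
move=> ch; apply: continuous_weakest => n x.
exact: (continuous_comp (ch x) (@continuous_coefGc R n _)).
Qed.

End Quotient.

Theorem theorem3p9 (R : realType) :
  is_topological_group (@mulQ R) (oneQ R) (@invQ R) /\
  (exists Pbar : QX R -> Gc R,
     unique (fun F : QX R -> Gc R => forall A : GX R, Phat A = F (piQ A)) Pbar /\
     is_topological_group_iso (@mulQ R) (@mulGc R) Pbar).
Proof.
split; last first.
  exists (@Pbar R); split.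
    split; first by move=> A; rewrite Pbar_piQ.
    by move=> F FP; apply/funext => q; rewrite -(piQ_reprQ q) -FP Pbar_piQ.
  split; first by move=> p q; exact: Pbar_mul.
  exists (@Pbar_inv R); split.
  - exact: PbarK.
  - exact: Pbar_invK.
  - exact: continuous_Pbar.
  - apply: continuous_into_QX.
    rewrite (_ : _ \o _ = id); first by move=> x; exact: cvg_id.
    by apply/funext => f; exact: Pbar_invK.
split.
- split.
  + by move=> p q r; apply: Pbar_inj; rewrite !Pbar_mul mulGcA.
  + by move=> q; apply: Pbar_inj; rewrite Pbar_mul Pbar_one mul1Gc.
  + by move=> q; apply: Pbar_inj; rewrite Pbar_mul Pbar_one mulGc1.
  + by move=> q; apply: Pbar_inj; rewrite Pbar_mul Pbar_one Pbar_mulVl.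
  + by move=> q; apply: Pbar_inj; rewrite Pbar_mul Pbar_one Pbar_mulV.
- apply: continuous_into_QX; apply: continuous_weakest => n.
  pose a (p : QX R * QX R) :=
    concatX (section_path (Pbar p.1)) (section_path (Pbar p.2)).
  rewrite (_ : _ \o _ = fun p => coefGc n (first_return (a p) : Gcset R)); last first.
    by apply/funext => p /=; rewrite Pbar_mul /a -first_return_concat !first_return_section.
  apply: continuous_return_coef => w.
  rewrite (_ : (fun x => _) = fun x => \sum_(j < (size w).+1)
     basic_int (take j w) (section_path (Pbar x.1)) *
     basic_int (drop j w) (section_path (Pbar x.2))); last first.
    apply/funext => x.
    exact: (congr1 (fun I => I w)
      (basic_int_concat (section_path (Pbar x.1)) (section_path (Pbar x.2)))).
  have c v : continuous (fun q : QX R => basic_int v (section_path (Pbar q))).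
    move=> q.
    exact: (continuous_comp (@continuous_Pbar R q) (@continuous_basic_int R v _)).
  apply: continuousC_sum => j; apply: continuousCM => x.
    exact: (@continuous_comp _ _ _ fst _ x cvg_fst (c (take j w) x.1)).
  exact: (@continuous_comp _ _ _ snd _ x cvg_snd (c (drop j w) x.2)).
- apply: continuous_into_QX; apply: continuous_weakest => n.
  rewrite (_ : _ \o _ = fun q => coefGc n
    (first_return (invX (section_path (Pbar q))) : Gcset R)); last first.
    by apply/funext => q /=; rewrite Pbar_invQ_section.
  apply: continuous_return_coef => w x.
  exact: (continuous_comp (@continuous_Pbar R _) (@continuous_basic_int_inv R _ _)).
Qed.
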